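(* For any Cherednik diagram $\lambda$ of degree $n$, the restriction of the rational function $\delta_\lambda\,\varphi_0$ to the affine subspace $\mathcal F_\lambda\subset\mathbb C(q)^{\times n}$ is regular and non-zero at the point $(x_1,\ldots,x_n)=(q^{c_1},\ldots,q^{c_n})$.
   Context: **Hecke algebra.** $q$ is a formal parameter. $\mathcal H_n$ is the associative $\mathbb C(q)$-algebra with generators $T_1,\ldots,T_{n-1}$ and relations $T_kT_{k+1}T_k=T_{k+1}T_kT_{k+1}$ for $1\le k\le n-2$; $T_kT_l=T_lT_k$ for $|k-l|>1$; $(T_k-q)(T_k+1)=0$ for $1\le k\le n-1$. $s_k=(k,k+1)\in\mathcal S_n$. **Cherednik diagrams.** A diagram $\lambda=(\lambda_1,\ldots,\lambda_r)$ with rows $\lambda_i=[a_i,b_i]$ (integers $a_i\le b_i$) is the set $\{(i,j)\in\mathbb Z^2\mid 1\le i\le r,\ a_i\le j\le b_i\}$, whose elements are called boxes; its degree is $n=\sum_i(b_i-a_i+1)$. It is a Cherednik diagram if for each $i=1,\ldots,r-1$ either $b_{i+1}\le b_i$, or $b_{i+1}=b_i+1$ and $a_{i+1}\le a_i+1$. The row filling $\Lambda$ of $\lambda$ is obtained by filling the boxes with $1,\ldots,n$, row by row from left to right and then from top (row $1$) to bottom (row $r$). The content of the box $(i,j)$ is $j-i$, and $c_k$ is the content of the box filled with $k$ in $\Lambda$. Rows $\lambda_i,\lambda_j$ are parallel if $a_i-i=a_j-j$ and $b_i-i=b_j-j$. **Functions.** For $x\in\mathbb C(q)$, $x\ne1$,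 put $\langle x\rangle=(1-q)/(1-x)$. Define the $\mathcal H_n$-valued rational functions $\varphi_k(x_1,\ldots,x_n)=T_k+\langle x_{k+1}/x_k\rangle$ of variables $x_1,\ldots,x_n$ from $\mathbb C(q)$. For $w\in\mathcal S_n$ and a rational function $\psi$ with values in $\mathcal H_n$ put ${}^w\psi(x_1,\ldots,x_n)=\psi(x_{w(1)},\ldots,x_{w(n)})$. For a reduced decomposition $w=s_{k_1}\cdots s_{k_m}$ define $\varphi_w=\varphi_{k_1}({}^{s_{k_1}}\varphi_{k_2})({}^{s_{k_1}s_{k_2}}\varphi_{k_3})\cdots({}^{s_{k_1}\cdots s_{k_{m-1}}}\varphi_{k_m})$; this does not depend on the choice of the reduced decomposition. Put $\varphi_0=\varphi_{w_0}$, where $w_0\in\mathcal S_n$ is the element of maximal length. $\delta_\lambda(x_1,\ldots,x_n)$ is the product of $1-x_l/x_k$ over all pairs $k<l$ such that $k,l$ occur in $\Lambda$ in the leftmost boxes of two parallel rows of $\lambda$ (with $\delta_\lambda=1$ if there are no distinct parallel rows). $\mathcal F_\lambda$ is the affine subspace of $\mathbb C(q)^{\times n}$ of all points $(x_1,\ldots,x_n)$ such that $x_kq^{c_l}=q^{c_k}x_l$ whenever $k$ and $l$ are in the same row of $\Lambda$. *)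

(* Defs.v *)
From HB Require Import structures.
From mathcomp Require Import all_boot all_order all_algebra all_fingroup.
From mathcomp Require Import generic_quotient boolp reals complex.
From mathcomp Require Import mpoly.
From mathcomp Require monalg.

Set Implicit Arguments.
Unset Strict Implicit.
Unset Printing Implicit Defensive.

Import GRing.Theory.
Local Open Scope ring_scope.
Local Open Scope quotient_scope.

(* C(q), for R the real numbers, and its formal parameter q. *)
Notation Cq R := {fraction {poly R[i]}}.
Definition qvar (R : realType) : Cq R := FracField.tofrac 'X.

(* The Hecke algebra with m generators over (K, q): the free associative algebra
   on 'I_m modulo the two-sided ideal generated by the defining relations.
   Generators are indexed from 0, so that H_n is [hecke q n.-1] and the
   generator T_(k+1) is [hT q k]. *)
Section Hecke.
Import monalg. (* local to the section: monalg and mpoly share names *)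
Variables (K : fieldType) (q : K) (m : nat).

Local Notation freealg := {malg K[{fmonom 'I_m}]}.

Definition gen (k : 'I_m) : freealg := mkmalgU (fmu k) 1.

Inductive hecke_relator : freealg -> Prop :=
| Braid (k l : 'I_m) : l = k.+1 :> nat ->
    hecke_relator (gen k * gen l * gen k - gen l * gen k * gen l)
| Commute (k l : 'I_m) : (k.+1 < l)%N ->
    hecke_relator (gen k * gen l - gen l * gen k)
| Quadratic (k : 'I_m) :
    hecke_relator ((gen k - q%:A) * (gen k + 1)).

Inductive hecke_ideal : freealg -> Prop :=
| HRel x : hecke_relator x -> hecke_ideal x
| H0 : hecke_ideal 0
| HAdd x y : hecke_ideal x -> hecke_ideal y -> hecke_ideal (x + y)
| HMull x y : hecke_ideal y -> hecke_ideal (x * y)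
| HMulr x y : hecke_ideal x -> hecke_ideal (x * y).

Definition heckeI : pred freealg := fun x => `[< hecke_ideal x >].

Lemma heckeIP x : reflect (hecke_ideal x) (x \in heckeI).
Proof. exact: asboolP. Qed.

Lemma heckeI_zmod : zmod_closed heckeI.
Proof.
split=> [|x y /heckeIP hx /heckeIP hy]; first by apply/heckeIP/H0.
by apply/heckeIP/HAdd=> //; rewrite -mulN1r; apply: HMull.
Qed.
HB.instance Definition _ := GRing.isZmodClosed.Build freealg heckeI heckeI_zmod.

Lemma heckeIMl x y : y \in heckeI -> x * y \in heckeI.
Proof. by move=> /heckeIP hy; apply/heckeIP/HMull. Qed.

Lemma heckeIMr x y : x \in heckeI -> x * y \in heckeI.
Proof. by move=> /heckeIP hx; apply/heckeIP/HMulr. Qed.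

Lemma heckeIZ a x : x \in heckeI -> a *: x \in heckeI.
Proof. by rewrite -[a *: x]mul_malgC; apply: heckeIMl. Qed.

(* The character T_k |-> q, which shows that the ideal is proper. *)
Definition qmon (s : {fmonom 'I_m}) : K := q ^+ size s.

Lemma qmon_morph : mmorphism qmon.
Proof. by split=> [s t|]; rewrite /qmon ?fm1 // fmM size_cat exprD. Qed.
HB.instance Definition _ :=
  isMultiplicative.Build {fmonom 'I_m} K qmon qmon_morph.

Definition qchar : freealg -> K := @mmap {fmonom 'I_m} K K idfun qmon.

Lemma qchar_gen k : qchar (gen k) = q.
Proof. by rewrite /qchar /gen mmapU /= mul1r /qmon fmU expr1. Qed.

Lemma qcharM x y : qchar (x * y) = qchar x * qchar y.
Proof. exact: (rmorphM (@mmap {fmonom 'I_m} K K idfun qmon)). Qed.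

Lemma qcharB x y : qchar (x - y) = qchar x - qchar y.
Proof. exact: (raddfB (@mmap {fmonom 'I_m} K K idfun qmon)). Qed.

Lemma qcharA a : qchar (a%:A) = a.
Proof. by rewrite /qchar mmapZ mmap1 mulr1. Qed.

Lemma qcharM2 k l : qchar (gen k * gen l) = q * q.
Proof. by rewrite (qcharM (gen k)) (qchar_gen k) (qchar_gen l). Qed.

Lemma qcharM3 k l j : qchar (gen k * gen l * gen j) = q * q * q.
Proof.
by rewrite (qcharM (gen k * gen l)) (qcharM2 k l) (qchar_gen j).
Qed.

Lemma qchar_ideal x : hecke_ideal x -> qchar x = 0.
Proof.
elim=> {x} [x [k l _|k l _|k]||x y _ hx _ hy|x y _ h|x y _ h].
- rewrite qcharB; apply/eqP; rewrite subr_eq0; apply/eqP.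
  exact: etrans (qcharM3 k l k) (esym (qcharM3 l k l)).
- rewrite qcharB; apply/eqP; rewrite subr_eq0; apply/eqP.
  exact: etrans (qcharM2 k l) (esym (qcharM2 l k)).
- by rewrite qcharM qcharB qchar_gen qcharA subrr mul0r.
- exact: mmap0.
- by rewrite -[y]opprK qcharB -[- y]sub0r qcharB hx hy /qchar mmap0 !subr0.
- by rewrite qcharM h mulr0.
- by rewrite qcharM h mul0r.
Qed.

Lemma heckeI1 : 1 \notin heckeI.
Proof.
by apply/heckeIP=> /qchar_ideal; rewrite /qchar mmap1; apply/eqP/oner_neq0.
Qed.

Definition hecke := Quotient.quot (GRing.ZmodClosed.clone freealg heckeI _).
HB.instance Definition _ := GRing.Zmodule.on hecke.

Local Notation pi := (\pi_hecke).

Lemma pi_eq x y : (pi x == pi y) = (x - y \in heckeI).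
Proof. by rewrite -Quotient.idealrBE. Qed.

Lemma piD x y : pi (x + y) = pi x + pi y :> hecke.
Proof. exact: raddfD. Qed.

Lemma pi_repr x : x - repr (pi x) \in heckeI.
Proof. by rewrite -pi_eq reprK. Qed.

Definition hone : hecke := pi 1.
(* Locked, lest unification unfold the product of the free algebra. *)
Fact hecke_key : unit. Proof. exact: tt. Qed.
Definition hmul := locked_with hecke_key
  (fun x y : hecke => pi (repr x * repr y) : hecke).
Definition hscale := locked_with hecke_key
  (fun (a : K) (x : hecke) => pi (a *: repr x) : hecke).

Lemma hmulE x y : hmul x y = pi (repr x * repr y).
Proof. by rewrite /hmul locked_withE. Qed.

Lemma hscaleE a x : hscale a x = pi (a *: repr x).
Proof. by rewrite /hscale locked_withE. Qed.

Lemma pi_mul x y : pi (x * y) = hmul (pi x) (pi y).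
Proof.
apply/eqP; rewrite hmulE pi_eq.
move: (repr (pi x)) (repr (pi y)) (pi_repr x) (pi_repr y).
move=> x' y' hx hy; have -> : x * y - x' * y' = x * (y - y') + (x - x') * y'.
  by rewrite mulrBr mulrBl addrA subrK.
by apply/heckeIP/HAdd; apply/heckeIP; [apply: heckeIMl|apply: heckeIMr].
Qed.

Lemma pi_scale a x : pi (a *: x) = hscale a (pi x).
Proof.
by apply/eqP; rewrite hscaleE pi_eq -scalerBr heckeIZ ?pi_repr.
Qed.

Lemma hecke_elim (P : hecke -> Prop) : (forall x, P (pi x)) -> forall x, P x.
Proof. by move=> h x; rewrite -[x]reprK. Qed.

Lemma hmulA : associative hmul.
Proof.
by do 3![elim/hecke_elim=> ?]; rewrite -!pi_mul mulrA.
Qed.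
Lemma hmul1l : left_id hone hmul.
Proof. by elim/hecke_elim=> x; rewrite -pi_mul mul1r. Qed.
Lemma hmul1r : right_id hone hmul.
Proof. by elim/hecke_elim=> x; rewrite -pi_mul mulr1. Qed.
Lemma hmulDl : left_distributive hmul +%R.
Proof. by do 3![elim/hecke_elim=> ?]; rewrite -!(piD, pi_mul) mulrDl. Qed.
Lemma hmulDr : right_distributive hmul +%R.
Proof. by do 3![elim/hecke_elim=> ?]; rewrite -!(piD, pi_mul) mulrDr. Qed.
Lemma hone_neq0 : hone != 0.
Proof. by rewrite -[0](raddf0 pi) pi_eq subr0 heckeI1. Qed.

HB.instance Definition _ := GRing.Zmodule_isNzRing.Build hecke
  hmulA hmul1l hmul1r hmulDl hmulDr hone_neq0.

Lemma hscaleA a b x : hscale a (hscale b x) = hscale (a * b) x.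
Proof. by elim/hecke_elim: x => x; rewrite -!pi_scale scalerA. Qed.
Lemma hscale1 : left_id 1 hscale.
Proof. by elim/hecke_elim=> x; rewrite -pi_scale scale1r. Qed.
Lemma hscaleDr : right_distributive hscale +%R.
Proof.
by move=> a; do 2![elim/hecke_elim=> ?]; rewrite -!(piD, pi_scale) scalerDr.
Qed.
Lemma hscaleDl x : {morph hscale^~ x : a b / a + b}.
Proof.
by move=> a b; elim/hecke_elim: x => x; rewrite -!pi_scale scalerDl piD.
Qed.

HB.instance Definition _ := GRing.Zmodule_isLmodule.Build K hecke
  hscaleA hscale1 hscaleDr hscaleDl.

Lemma hscaleAl (a : K) (x y : hecke) : a *: (x * y) = (a *: x) * y.
Proof.
elim/hecke_elim: x => x; elim/hecke_elim: y => y.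
by rewrite -[LHS]/(hscale a (hmul _ _)) -[RHS]/(hmul (hscale a _) _)
   -!(pi_mul, pi_scale) scalerAl.
Qed.

HB.instance Definition _ := GRing.Lmodule_isLalgebra.Build K hecke hscaleAl.

Lemma freealg_scaleAr a (x y : {malg K[{fmonom 'I_m}]}) : a *: (x * y) = x * (a *: y).
Proof.
rewrite (monalgE x) mulr_suml scaler_sumr mulr_suml; apply: eq_bigr => s _.
rewrite (monalgE y) mulr_sumr !scaler_sumr mulr_sumr; apply: eq_bigr => t _.
have MZ b c (u : {fmonom 'I_m}) :
    b *: (mkmalgU u c : {malg K[_]}) = mkmalgU u (b * c).
  by apply/malgP=> v; rewrite mcoeffZ !mcoeffU mulrnAr.
have MU b c (u v : {fmonom 'I_m}) : (mkmalgU u b : {malg K[_]}) * mkmalgU v c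
    = mkmalgU (mmul u v) (b * c) by exact: fgmulUU.
by rewrite !(MZ, MU) mulrCA.
Qed.

Lemma hscaleAr (a : K) (x y : hecke) : a *: (x * y) = x * (a *: y).
Proof.
elim/hecke_elim: x => x; elim/hecke_elim: y => y.
by rewrite -[LHS]/(hscale a (hmul _ _)) -[RHS]/(hmul _ (hscale a _))
   -!(pi_mul, pi_scale) freealg_scaleAr.
Qed.

HB.instance Definition _ := GRing.Lalgebra_isAlgebra.Build K hecke hscaleAr.

Definition hpi (x : freealg) : hecke := pi x.

Lemma hpiB x y : hpi (x - y) = hpi x - hpi y.
Proof. exact: raddfB. Qed.

Lemma hpiM x y : hpi (x * y) = hpi x * hpi y.
Proof. exact: pi_mul. Qed.

Lemma hpiZ a x : hpi (a *: x) = a *: hpi x.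
Proof. exact: pi_scale. Qed.

Lemma hpi_eq0 x : hecke_ideal x -> hpi x = 0.
Proof.
move=> hx; rewrite -[RHS](raddf0 pi); apply/eqP.
by rewrite pi_eq subr0; apply/heckeIP.
Qed.

Definition hT (k : 'I_m) : hecke := hpi (gen k).

Lemma hpiM3 x y z : hpi (x * y * z) = hpi x * hpi y * hpi z.
Proof. by rewrite hpiM hpiM. Qed.

Lemma hT_braid (k l : 'I_m) : l = k.+1 :> nat ->
  hT k * hT l * hT k = hT l * hT k * hT l.
Proof.
move=> /Braid/HRel/hpi_eq0; rewrite hpiB => /subr0_eq E.
exact: etrans (esym (hpiM3 (gen k) (gen l) (gen k)))
              (etrans E (hpiM3 (gen l) (gen k) (gen l))).
Qed.

Lemma hT_commute (k l : 'I_m) : (k.+1 < l)%N -> hT k * hT l = hT l * hT k.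
Proof.
move=> /Commute/HRel/hpi_eq0; rewrite hpiB => /subr0_eq E.
exact: etrans (esym (hpiM (gen k) (gen l))) (etrans E (hpiM (gen l) (gen k))).
Qed.

Lemma hT_quadratic (k : 'I_m) : (hT k - q%:A) * (hT k + 1) = 0.
Proof.
apply: etrans (hpi_eq0 (HRel (Quadratic k))).
rewrite (hpiM (gen k - q%:A)) (hpiB (gen k)) (hpiZ q 1).
by congr (_ * _); symmetry; apply: piD.
Qed.

End Hecke.

(* Adjacent transpositions and reduced words, with everything indexed from 0. *)
Section Words.
Variable n : nat.
Implicit Types (w : 'S_n) (k : 'I_n.-1) (s : seq 'I_n.-1).

Lemma lo_subproof k : (k < n)%N.
Proof. exact: leq_trans (ltn_ord k) (leq_pred n). Qed.

Lemma hi_subproof k : (k.+1 < n)%N.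
Proof. by case: n k => [|n'] [k hk]. Qed.

Definition lo k : 'I_n := Ordinal (lo_subproof k).
Definition hi k : 'I_n := Ordinal (hi_subproof k).

Definition adj_transp k : 'S_n := tperm (lo k) (hi k).

(* s_{k_1} ... s_{k_m} as a composition of maps, rightmost factor applied first;
   the product of 'S_n applies its left factor first, hence the reversal. *)
Definition word_perm s : 'S_n := (\prod_(k <- rev s) adj_transp k)%g.

Definition reduced w s :=
  word_perm s = w /\ forall s', word_perm s' = w -> (size s <= size s')%N.

Definition longest w :=
  forall w' s s', reduced w s -> reduced w' s' -> (size s' <= size s)%N.

End Words.

Section Phi.
Variables (K : fieldType) (q : K) (n : nat).
Local Notation point := ('I_n -> K).

Definition bracket (x : K) : K := (1 - q) / (1 - x).

Definition phi (k : 'I_n.-1) (x : point) : hecke q n.-1 :=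
  hT q k + (bracket (x (hi k) / x (lo k)))%:A.

Definition twist (V : Type) (w : 'S_n) (psi : point -> V) : point -> V :=
  fun x => psi (fun i => x (w i)).

Definition phi_word (s : seq 'I_n.-1) (x : point) : hecke q n.-1 :=
  \prod_(i < size s)
     twist (word_perm (take i s)) (phi (tnth (in_tuple s) i)) x.

(* A dense open set of points at which the formulas for all the [phi_word s],
   and for [delta] below, involve no division by 0. *)
Definition generic (x : point) : Prop :=
  injective x /\ forall k, x k != 0.

(* F is an irreducible closed subset of the affine space, and psi a V-valued
   rational function given by its values on the dense open set dom. As dom meets
   F, the restriction of psi to F is defined; it is regular at p with value v
   when it can be written N / Q, with N a V-valued polynomial, Q a scalar
   polynomial and Q(p) <> 0, so that v = N(p) / Q(p). *)
Definition restriction_regular_at (V : lmodType K) (F dom : point -> Prop)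
    (psi : point -> V) (p : point) (v : V) : Prop :=
  [/\ F p, exists x, F x /\ dom x &
    exists (m : nat) (P : 'I_m -> {mpoly K[n]}) (e : 'I_m -> V)
           (Q : {mpoly K[n]}),
      let N (x : point) := \sum_(j < m) (P j).@[x] *: e j in
      [/\ Q.@[p] != 0, v = (Q.@[p])^-1 *: N p &
          forall x, F x -> dom x -> Q.@[x] *: psi x = N x]].

End Phi.

(* A diagram is the list of its rows (a_i, b_i). Rows are numbered from 1, and a
   box is a pair (row, column). *)
Section Diagram.
Implicit Types la : seq (int * int).

Definition cherednik la : bool :=
  all (fun r => r.1 <= r.2) la &&
  sorted (fun r r' => (r'.2 <= r.2) || (r'.2 == r.2 + 1) && (r'.1 <= r.1 + 1)) la.

Definition degree la : nat := (\sum_(r <- la) absz (r.2 - r.1 + 1)%R)%N.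

Definition row la (i : nat) : int * int := nth (0, 0) la i.-1.

Definition boxes la : seq (nat * int) :=
  [seq (i, (row la i).1 + j%:Z) | i <- iota 1 (size la),
     j <- iota 0 (absz ((row la i).2 - (row la i).1 + 1)%R)].

(* The row filling; k : 'I_(degree la) stands for the entry k + 1. *)
Definition box la (k : 'I_(degree la)) : nat * int := nth (0%N, 0) (boxes la) k.

Definition content la (k : 'I_(degree la)) : int := (box k).2 - (box k).1%:Z.

Definition parallel la (i j : nat) : bool :=
  ((row la i).1 - i%:Z == (row la j).1 - j%:Z) &&
  ((row la i).2 - i%:Z == (row la j).2 - j%:Z).

Definition leftmost la (k : 'I_(degree la)) : bool :=
  (box k).2 == (row la (box k).1).1.

Variables (K : fieldType) (q : K).

Definition delta la (x : 'I_(degree la) -> K) : K :=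
  \prod_(k < degree la)
   \prod_(l < degree la | [&& (k < l)%N, leftmost k, leftmost l &
                              parallel la (box k).1 (box l).1])
     (1 - x l / x k).

Definition Fspace la (x : 'I_(degree la) -> K) : Prop :=
  forall k l : 'I_(degree la), (box k).1 = (box l).1 ->
    x k * q ^ content l = q ^ content k * x l.

Definition content_point la (k : 'I_(degree la)) : K := q ^ content k.

End Diagram.

(* Main.v *)
Require Import Defs.
From mathcomp Require Import all_boot all_order all_algebra all_fingroup.
From mathcomp Require Import zify ring.
From mathcomp Require Import boolp reals complex.
From mathcomp Require Import mpoly.
From mathcomp Require monalg.
Set Implicit Arguments.
Unset Strict Implicit.
Unset Printing Implicit Defensive.
Import Order.TTheory GRing.Theory Num.Theory.
Local Open Scope ring_scope.

(** The value of delta * phi_0 on the family F is studied through the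
    arrangements of the labels met along a reduced decomposition of w_0. A
    reduced decomposition exchanges the labels k < l once for each pair, and the
    exchange contributes a factor [T + <x_l / x_k>], whose only possible pole at
    the point (q^c_1, ..., q^c_n) comes from a pair of boxes with the same
    content.

    _Regularity._ By the Yang-Baxter equation ([yang_baxter]), the product
    depends only on the permutation and not on the reduced decomposition
    ([phi_word_reduced]), so the order of the exchanges is free; moreover, as
    soon as the neighbours a, a+1 of a row have been exchanged, the product so
    far is divisible on the right by [T + 1] ([phi_perm_absorb]). If then b
    crosses a and a+1 one after the other, the two factors preceded by [T + 1]
    are regular although the crossing of a and b alone is singular: this is the
    identity [fusion], and it rests on (T + 1)(T - q) = 0. The same holds when a
    crosses two neighbours of the row of b. Thus a singular crossing is harmless
    if the box of a has a right neighbour, or if the box of b has a left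
    neighbour. Let a lie in an earlier row than b. The rows of a Cherednik
    diagram are ordered by decreasing last content and, for equal last contents,
    by decreasing first content. If the last contents differ, every singular a
    has a right neighbour; if they agree, every singular b has a left neighbour,
    except when both rows are parallel and a, b are their leftmost boxes, and
    that pair has its own factor in delta. This is [crosses_rows].

    _Nonvanishing._ Give each label the class of rows parallel to its own as a
    letter. The algebra acts on the functions on words in these letters by the
    R-matrix of type A ([hecke_act]). In the image of the initial word under
    phi_w, the coefficient of the word rearranged by w is the product of
    q + <x_l / x_k> over the inverted pairs with equal letters
    ([word_coef_leading]); this takes the place of the coefficient of T_w
    relative to a parabolic subalgebra. For w_0, the product along a row
    telescopes, and delta removes its poles exactly, leaving a nonzero value
    ([delta_leading_unit]). A polynomial that vanishes on the generic points of
    F also vanishes at the given point ([family_dense]), so that value is indeed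
    the one taken by the functional on the regular function. *)

(** * Inversions of permutations and reduced words *)

Section Inversions.
Variable n : nat.
Implicit Types (w : 'S_n) (k l : 'I_n.-1) (s t : seq 'I_n.-1).

(** A permutation w is read as the arrangement with the label [w i] at position
    i. Inversions are recorded as pairs of labels, so that exchanging two
    neighbours adds or removes a single pair and leaves the others as they are. *)
Definition inversions w : {set 'I_n * 'I_n} :=
  [set p : 'I_n * 'I_n | (p.1 < p.2)%N & ((w^-1)%g p.2 < (w^-1)%g p.1)%N].

Definition ascent w k := (w (lo k) < w (hi k))%N.

Definition reduced_word s := #|inversions (word_perm s)| == size s.

Lemma adj_transpK k : (adj_transp k * adj_transp k = 1)%g.
Proof. exact: tperm2. Qed.

Lemma adj_mulK k w : (adj_transp k * (adj_transp k * w) = w)%g.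
Proof. by rewrite mulgA adj_transpK mul1g. Qed.

Lemma word_perm_rcons s k :
  word_perm (rcons s k) = (adj_transp k * word_perm s)%g.
Proof. by rewrite /word_perm rev_rcons big_cons. Qed.

Lemma lo_neq_hi k : lo k != hi k.
Proof. by rewrite -val_eqE /= neq_ltn ltnSn. Qed.

Lemma adj_lo w k : (adj_transp k * w)%g (lo k) = w (hi k).
Proof. by rewrite permM tpermL. Qed.

Lemma adj_hi w k : (adj_transp k * w)%g (hi k) = w (lo k).
Proof. by rewrite permM tpermR. Qed.

Lemma not_ascent w k : ~~ ascent w k = (w (hi k) < w (lo k))%N.
Proof.
rewrite /ascent -leqNgt leq_eqVlt val_eqE (inj_eq perm_inj) eq_sym.
by rewrite (negPf (lo_neq_hi k)).
Qed.

Lemma ascent_adj w k : ascent (adj_transp k * w)%g k = ~~ ascent w k.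
Proof. by rewrite not_ascent /ascent adj_lo adj_hi. Qed.

Lemma adj_transp_lt k (i j : 'I_n) : (i, j) != (lo k, hi k) ->
  (i, j) != (hi k, lo k) -> (adj_transp k i < adj_transp k j)%N = (i < j)%N.
Proof.
rewrite /adj_transp => h1 h2.
case: tpermP h1 h2 => [->|->|/eqP + /eqP]; case: tpermP => [->|->|/eqP + /eqP];
  by rewrite ?xpair_eqE -?val_eqE /=; lia.
Qed.

Lemma inversions_adj w k : ascent w k ->
  inversions (adj_transp k * w)%g = (w (lo k), w (hi k)) |: inversions w.
Proof.
move=> asc; apply/setP=> -[a b]; rewrite !inE /= invMg !permM tpermV.
rewrite -[X in X == _]/(a, b).
set i := (w^-1)%g a; set j := (w^-1)%g b.
have -> : ((a, b) == (w (lo k), w (hi k))) = ((i, j) == (lo k, hi k)).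
  by rewrite -{1}[a](permKV w) -{1}[b](permKV w) !xpair_eqE !(inj_eq perm_inj).
have [ba|] := boolP ((j, i) == (lo k, hi k)).
  case/eqP: ba => jl ih.
  have -> : a = w (hi k) by rewrite -ih /i permKV.
  have -> : b = w (lo k) by rewrite -jl /j permKV.
  rewrite jl ih; move: asc; rewrite /ascent xpair_eqE eq_sym.
  by rewrite (negPf (lo_neq_hi k)) => asc; rewrite !ltnNge (ltnW asc).
have [/eqP[il jh] _|h1 h2] := boolP ((i, j) == (lo k, hi k)).
  have -> : a = w (lo k) by rewrite -il /i permKV.
  have -> : b = w (hi k) by rewrite -jh /j permKV.
  by rewrite il jh /adj_transp tpermL tpermR /= ltnSn andbT; exact: asc.
rewrite adj_transp_lt //.
by move: h1; rewrite !xpair_eqE andbC.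
Qed.

Lemma inversions_adj_notin w k : (w (lo k), w (hi k)) \notin inversions w.
Proof. by rewrite !inE /= !permK /= negb_and -!leqNgt leqnSn orbT. Qed.

Lemma card_inversions_adj w k : ascent w k ->
  #|inversions (adj_transp k * w)%g| = #|inversions w|.+1.
Proof.
by move=> asc; rewrite inversions_adj // cardsU1 inversions_adj_notin.
Qed.

Lemma inversions1 : inversions 1%g = set0.
Proof.
by apply/setP=> -[a b]; rewrite !inE /= invg1 !perm1; case: ltngtP.
Qed.

(** With [exists_reduced_word], this identifies the length of w with its number
    of inversions. *)
Lemma card_inversions_word s : (#|inversions (word_perm s)| <= size s)%N.
Proof.
elim/last_ind: s => [|s k IH].
  by rewrite /word_perm big_nil inversions1 cards0.
rewrite word_perm_rcons size_rcons.
case: (boolP (ascent (word_perm s) k)) => [asc|dsc].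
  by rewrite card_inversions_adj.
have := @card_inversions_adj (adj_transp k * word_perm s)%g k.
rewrite ascent_adj adj_mulK => /(_ dsc) E.
by apply: leq_trans (leq_trans _ IH) (leqnSn _); rewrite E.
Qed.

Lemma reduced_word_rcons s k :
  reduced_word (rcons s k) = reduced_word s && ascent (word_perm s) k.
Proof.
rewrite /reduced_word word_perm_rcons size_rcons.
have := card_inversions_word s.
case: (boolP (ascent (word_perm s) k)) => [asc _|dsc le].
  by rewrite card_inversions_adj // eqSS andbT.
have := @card_inversions_adj (adj_transp k * word_perm s)%g k.
rewrite ascent_adj adj_mulK => /(_ dsc) E; rewrite andbF.
by apply/eqP; move: le; rewrite E; lia.
Qed.

Lemma increasing_perm1 w :
  (forall i j : 'I_n, (i < j)%N -> (w i < w j)%N) -> w = 1%g.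
Proof.
move=> incr.
have ge (u : 'S_n) : (forall i j : 'I_n, (i < j)%N -> (u i < u j)%N) ->
    forall i : 'I_n, (i <= u i)%N.
  move=> inc [m]; elim: m => // m IH hm.
  exact: leq_ltn_trans (IH (ltnW hm)) (inc (Ordinal (ltnW hm)) (Ordinal hm) _).
apply/permP=> i; rewrite perm1; apply/val_inj/eqP; rewrite eqn_leq (ge w) //.
rewrite andbT -{2}(permK w i).
apply: ge => {}i j ij; rewrite ltnNge; apply/negP.
rewrite leq_eqVlt val_eqE (inj_eq perm_inj) => /orP[/eqP ji|/incr].
  by rewrite ji ltnn in ij.
by rewrite !permKV ltnNge ltnW.
Qed.

(** Hence every permutation other than 1 has a descent, which can be taken as
    the last letter of a reduced word. *)
Lemma ascents_perm1 w : (forall k, ascent w k) -> w = 1%g.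
Proof.
move=> asc; apply: increasing_perm1 => -[i hi'] [j hj] /=.
elim: j hj => // j IH hj; rewrite ltnS leq_eqVlt => ij.
have hk : (j < n.-1)%N by case: n hj => // n' hj; rewrite -ltnS.
have := asc (Ordinal hk); rewrite /ascent.
have -> : lo (Ordinal hk) = Ordinal (ltnW hj) by apply: val_inj.
have -> : hi (Ordinal hk) = Ordinal hj by apply: val_inj.
case/predU1P: ij => [eij|ij]; last exact: ltn_trans (IH _ ij).
by have -> : Ordinal hi' = Ordinal (ltnW hj) by apply: val_inj.
Qed.

Lemma exists_reduced_word w : exists s, reduced_word s /\ word_perm s = w.
Proof.
have [m] := ubnP #|inversions w|; elim: m w => // m IH w lem.
have [asc|/existsNP[k dsc]] := pselect (forall k, ascent w k).
  exists [::]; rewrite /reduced_word /word_perm big_nil (ascents_perm1 asc).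
  by rewrite inversions1 cards0.
have dsc' : ascent (adj_transp k * w)%g k by rewrite ascent_adj; apply/negP.
have [|s [rs sw]] := IH (adj_transp k * w)%g.
  by move: lem; rewrite -{1}[w](adj_mulK k) card_inversions_adj.
by exists (rcons s k); rewrite reduced_word_rcons word_perm_rcons sw adj_mulK rs.
Qed.

Lemma reducedP w s : reduced w s -> reduced_word s.
Proof.
case=> sw min; have [t [/eqP rt tw]] := exists_reduced_word w.
rewrite /reduced_word eqn_leq card_inversions_word sw -tw rt /=.
exact: min.
Qed.

Lemma reduced_wordP s : reduced_word s -> reduced (word_perm s) s.
Proof.
by move=> /eqP rs; split=> // t tw; rewrite -rs -tw card_inversions_word.
Qed.

(** An ascent of w could be exchanged, giving a permutation with a longer
    reduced word. *)
Lemma longest_descents w k : longest w -> ~~ ascent w k.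
Proof.
move=> lw; apply/negP=> asc; have [s [rs sw]] := exists_reduced_word w.
have rk : reduced_word (rcons s k) by rewrite reduced_word_rcons rs sw.
have := lw _ _ _ _ (reduced_wordP rk).
rewrite -{1}sw => /(_ s (reduced_wordP rs)).
by rewrite size_rcons ltnn.
Qed.

Lemma longest_rev w i : longest w -> w i = rev_ord i.
Proof.
move=> lw; have rK : cancel (@rev_ord n) (@rev_ord n) by exact: rev_ordK.
pose r := perm (can_inj rK); suff E : (w * r = 1)%g.
  by move/permP: E => /(_ i); rewrite permM perm1 permE => E; rewrite -{1}[w i]rev_ordK E.

apply: (@ascents_perm1 (w * r)%g) => k; rewrite /ascent !permM !permE /=.
have := longest_descents k lw; rewrite not_ascent.
by have := ltn_ord (w (lo k)); have := ltn_ord (w (hi k)); lia.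
Qed.

Lemma longest_inversions w (a b : 'I_n) : longest w ->
  ((a, b) \in inversions w) = (a < b)%N.
Proof.
move=> lw; have E i : (w^-1)%g i = rev_ord i.
  by apply: (@perm_inj _ w); rewrite permKV (longest_rev _ lw) rev_ordK.
rewrite inE /= !E /=; case: ltnP => //= ab.
by have := ltn_ord b; lia.
Qed.

End Inversions.
(** * Relations between adjacent transpositions *)

Section AdjacentTranspositions.
Variable n : nat.
Implicit Types (w : 'S_n) (k l : 'I_n.-1).

Lemma adj_fix k (i : 'I_n) : i != k :> nat -> i != k.+1 :> nat -> adj_transp k i = i.
Proof.
by move=> ik ik'; rewrite tpermD // -val_eqE /= eq_sym.
Qed.

Lemma adj_at_lo k : adj_transp k (lo k) = hi k. Proof. exact: tpermL. Qed.
Lemma adj_at_hi k : adj_transp k (hi k) = lo k. Proof. exact: tpermR. Qed.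

Lemma mul_tperm_conj (s t : 'S_n) i j : s = tperm i j -> (s * t = t * tperm (t i) (t j))%g.
Proof. by move=> ->; rewrite conjgC tpermJ. Qed.

Lemma adj_commute k l : (k.+1 < l)%N ->
  (adj_transp k * adj_transp l = adj_transp l * adj_transp k)%g.
Proof.
move=> kl; rewrite (mul_tperm_conj _ (erefl (adj_transp k))).
by rewrite !adj_fix //=; lia.
Qed.

Section Neighbours.
Variables (k l : 'I_n.-1).
Hypothesis lk : l = k.+1 :> nat.

Lemma hi_lo : hi k = lo l. Proof. by apply: val_inj; rewrite /= lk. Qed.
Lemma adj_next_lo : adj_transp l (lo k) = lo k.
Proof. by rewrite adj_fix //= lk; lia. Qed.
Lemma adj_prev_hi : adj_transp k (hi l) = hi l.
Proof. by rewrite adj_fix //= lk; lia. Qed.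
Lemma adj_prev_lo : adj_transp k (lo k) = lo l.
Proof. by rewrite /adj_transp hi_lo tpermL. Qed.
Lemma adj_prev_mid : adj_transp k (lo l) = lo k.
Proof. by rewrite /adj_transp hi_lo tpermR. Qed.

Definition adj_nextE :=
  (hi_lo, adj_next_lo, adj_prev_hi, adj_prev_lo, adj_prev_mid, adj_at_lo l, adj_at_hi l).

Lemma adj_braid : (adj_transp k * (adj_transp l * adj_transp k) =
                   adj_transp l * (adj_transp k * adj_transp l))%g.
Proof.
rewrite (mul_tperm_conj _ (erefl (adj_transp l))) adj_mulK.
by rewrite (mul_tperm_conj _ (erefl (adj_transp k))) adj_mulK !adj_nextE.
Qed.
End Neighbours.
End AdjacentTranspositions.

(** * The Yang-Baxter equation and the elements phi_w *)

Section YangBaxter.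
Variables (K : fieldType) (q : K) (n : nat).
Implicit Types (w : 'S_n) (k l : 'I_n.-1) (s t : seq 'I_n.-1) (x : 'I_n -> K).
Local Notation H := (hecke q n.-1).
Local Notation T := (hT q).

Lemma phi_word_nil x : phi_word q [::] x = 1.
Proof. exact: big_ord0. Qed.

Lemma phi_word_rcons s k x :
  phi_word q (rcons s k) x = phi_word q s x * phi q k (fun i => x (word_perm s i)).
Proof.
have E t : phi_word q t x = \prod_(0 <= i < size t)
    twist (word_perm (take i t)) (phi q (nth k t i)) x.
  by rewrite big_mkord; apply: eq_bigr => i _; rewrite (tnth_nth k).
rewrite !E size_rcons big_nat_recr //=; congr (_ * _).
  apply: eq_big_nat => i /andP[_ lti].
  by rewrite -cats1 takel_cat 1?ltnW // nth_cat lti.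
by rewrite nth_rcons ltnn eqxx -cats1 takel_cat // take_size.
Qed.

Lemma hT_sqr k : T k * T k = (q - 1) *: T k + q%:A.
Proof.
apply/eqP; rewrite -subr_eq0 -(hT_quadratic q k); apply/eqP.
rewrite mulrDr mulr1 mulrBl -scalerAl mul1r scalerBl scale1r opprD opprB !addrA.
by congr (_ - _); rewrite addrAC.
Qed.

Lemma bracketE (a b : K) : a != 0 -> bracket q (b / a) = (1 - q) * a / (a - b).
Proof.
move=> a0; rewrite /bracket.
have -> : 1 - b / a = (a - b) / a by field.
by rewrite invf_div mulrA.
Qed.

(** The part of the Yang-Baxter equation that does not hold term by term: the
    difference of its two sides is this scalar times T_k - T_(k+1). *)
Lemma yang_baxter_scalar (a b c : K) : a != 0 -> b != 0 ->
  a != b -> b != c -> a != c ->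
  bracket q (c / a) * (q - 1) + bracket q (b / a) * bracket q (c / a)
  + bracket q (c / a) * bracket q (c / b) - bracket q (b / a) * bracket q (c / b) = 0.
Proof.
move=> a0 b0; rewrite -(subr_eq0 a) -(subr_eq0 b) -(subr_eq0 a) !bracketE // => ab bc ac.
by field; rewrite ab bc ac.
Qed.

Lemma triple_expansion (X Y : H) (u v w : K) :
  (X + u%:A) * (Y + v%:A) * (X + w%:A) =
    X * Y * X + v *: (X * X) + w *: (X * Y) + u *: (Y * X) +
    ((v * w + u * v) *: X + (u * w) *: Y + (u * v * w)%:A).
Proof.
rewrite !(mulrDl, mulrDr, mulr_algl, mulr_algr, scalerDr) -!scalerAl.
rewrite !(mulr_algl, scalerA, scalerDl) -!addrA.
rewrite mul1r; do 2 congr (_ + _).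
have swap (V : zmodType) (e f c d r : V) :
    e + (f + (c + (d + r))) = c + (e + (d + (f + r))).
  by rewrite (addrCA f c) (addrCA e c) (addrCA f d).
by rewrite swap (mulrC w v) (mulrC w u) (mulrAC u v w).
Qed.

Lemma yang_baxter (A B : H) (a b c : K) :
    A * B * A = B * A * B -> A * A = (q - 1) *: A + q%:A ->
    B * B = (q - 1) *: B + q%:A ->
    b * (q - 1) + a * b + b * c - a * c = 0 ->
  (A + a%:A) * (B + b%:A) * (A + c%:A) = (B + c%:A) * (A + b%:A) * (B + a%:A).
Proof.
move=> AB A2 B2 abc; rewrite !triple_expansion AB A2 B2.
have acA : c * a = b * (q - 1) + (b * c + a * b).
  by apply/esym/eqP; rewrite -subr_eq0 -abc; apply/eqP; ring.
have acB : a * c = b * (q - 1) + (b * a + c * b) by rewrite (mulrC a) acA; ring.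
rewrite acA acB !scalerDr !scalerA !(scalerDl _ (b * (q - 1))) -!addrA.
congr (_ + _); rewrite (mulrAC c b a) (mulrC c a) (mulrAC a c b) !addrA.
by rewrite [LHS](ACl (6*2*4*3*7*1*5*8))%AC.
Qed.

Lemma phi_braid k l x : l = k.+1 :> nat ->
    x (lo k) != 0 -> x (lo l) != 0 -> x (lo k) != x (lo l) ->
    x (lo l) != x (hi l) -> x (lo k) != x (hi l) ->
  phi q k x * phi q l (fun i => x (adj_transp k i)) *
    phi q k (fun i => x (adj_transp k (adj_transp l i))) =
  phi q l x * phi q k (fun i => x (adj_transp l i)) *
    phi q l (fun i => x (adj_transp l (adj_transp k i))).
Proof.
move=> lk x0 x1 x01 x12 x02; rewrite /phi !(adj_nextE lk).
apply: yang_baxter; [exact: hT_braid|exact: hT_sqr|exact: hT_sqr|].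
by rewrite yang_baxter_scalar.
Qed.

Lemma phi_commute k l x : (k.+1 < l)%N ->
  phi q k x * phi q l (fun i => x (adj_transp k i)) =
  phi q l x * phi q k (fun i => x (adj_transp l i)).
Proof.
move=> kl; rewrite /phi !adj_fix /=; try lia.
rewrite !(mulrDl, mulrDr) hT_commute // !mulr_algl !mulr_algr -!addrA.
congr (_ + _); rewrite !scalerA addrCA; congr (_ + (_ + _ *: _)); exact: mulrC.
Qed.

Lemma point_permM (u w : 'S_n) x :
  (fun i => x ((u * w)%g i)) = (fun i => x (w (u i))).
Proof. by apply/funext => i; rewrite permM. Qed.

Lemma point_permM2 (t u w : 'S_n) x :
  (fun i => x ((t * (u * w))%g i)) = (fun i => x (w (u (t i)))).
Proof. by apply/funext => i; rewrite !permM. Qed.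

(** Matsumoto's theorem for the elements phi, by induction on the length. Two
    reduced words of w ending in k and in l are compared through a reduced word u
    of the permutation in which the labels at the positions moved by k and l are
    sorted: u can be completed to a word of w that ends in l k or k l for distant
    k and l, and in k l k or l k l for neighbours. *)
Lemma phi_word_reduced s t x : generic x ->
  reduced_word s -> reduced_word t -> word_perm s = word_perm t ->
  phi_word q s x = phi_word q t x.
Proof.
move=> [xI x0]; have xD (i j : 'I_n) : i != j -> x i != x j.
  by apply: contraNneq => /xI ->.
have [m] := ubnP (size s); elim: m s t => // m IH s t lem rs rt st.
have : size s = size t by rewrite -(eqP rs) -(eqP rt) st.
case: (lastP s) lem rs st => [|s' k] lem rs st.
  by move/esym/size0nil->.
case: (lastP t) rt st => [|t' l] rt st; first by rewrite size_rcons.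
rewrite !size_rcons => -[sz]; rewrite size_rcons ltnS in lem.
wlog kl : k l s' t' rs rt st lem sz / (k <= l)%N.
  move=> W; case: (leqP k l) => [|/ltnW] kl; first exact: (W k l s' t' rs rt st lem sz kl).
  by symmetry; apply: (W l k t' s') => //; rewrite -?sz.
move: rs rt; rewrite !reduced_word_rcons => /andP[rs' ak] /andP[rt' al].
move: st; rewrite !word_perm_rcons; set w := (_ * _)%g => wt.
have Es : word_perm s' = (adj_transp k * w)%g by rewrite /w adj_mulK.
have Et : word_perm t' = (adj_transp l * w)%g by rewrite wt adj_mulK.
clearbody w.
have dk : (w (hi k) < w (lo k))%N by rewrite -not_ascent -ascent_adj -Es.
have dl : (w (hi l) < w (lo l))%N by rewrite -not_ascent -ascent_adj -Et.
rewrite !phi_word_rcons.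
case: (ltngtP k l) kl => // [kl _|/val_inj kl _]; last first.
  by rewrite (IH s' t') // ?Es ?Et kl.
case: (ltngtP k.+1 l) kl => // [kl _|kl _].
  pose v := (adj_transp l * (adj_transp k * w))%g.
  have v' : v = (adj_transp k * (adj_transp l * w))%g by rewrite /v !mulgA (adj_commute kl).
  have [u [ru uv]] := exists_reduced_word v.
  have rul : reduced_word (rcons u l).
    rewrite reduced_word_rcons ru uv /ascent !permM !adj_at_lo !adj_at_hi.
    by rewrite !adj_fix //=; lia.
  have ruk : reduced_word (rcons u k).
    rewrite reduced_word_rcons ru uv v' /ascent !permM !adj_at_lo !adj_at_hi.
    by rewrite !adj_fix //=; lia.
  have w1 : word_perm s' = word_perm (rcons u l) by rewrite word_perm_rcons uv Es adj_mulK.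
  have w2 : word_perm t' = word_perm (rcons u k) by rewrite word_perm_rcons uv v' Et adj_mulK.
  rewrite (IH s' (rcons u l)) // (IH t' (rcons u k)) -?sz // !phi_word_rcons w1 w2.
  rewrite !word_perm_rcons uv -!mulrA; congr (_ * _).
  clearbody v; rewrite !point_permM; symmetry.
  exact: (@phi_commute k l (fun i => x (v i)) kl).
pose v := (adj_transp k * (adj_transp l * (adj_transp k * w)))%g.
have lk : l = k.+1 :> nat by [].
have v' : v = (adj_transp l * (adj_transp k * (adj_transp l * w)))%g.
  by rewrite /v ![in LHS]mulgA -(mulgA (adj_transp k)) (adj_braid lk) !mulgA.
have [u [ru uv]] := exists_reduced_word v.
rewrite !(adj_nextE lk) in dk dl.
have rukl : reduced_word (rcons (rcons u k) l).
  rewrite !reduced_word_rcons ru word_perm_rcons uv /ascent !permM !(adj_nextE lk).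
  by rewrite dl /=; exact: ltn_trans dl dk.
have rulk : reduced_word (rcons (rcons u l) k).
  rewrite !reduced_word_rcons ru word_perm_rcons uv /ascent !permM !(adj_nextE lk).
  by rewrite dk /=; exact: ltn_trans dl dk.
have w1 : word_perm s' = word_perm (rcons (rcons u k) l).
  by rewrite !word_perm_rcons uv Es !adj_mulK.
have w2 : word_perm t' = word_perm (rcons (rcons u l) k).
  by rewrite !word_perm_rcons uv v' Et !adj_mulK.
rewrite (IH s' (rcons (rcons u k) l)) // (IH t' (rcons (rcons u l) k)) -?sz //.
rewrite !phi_word_rcons w1 w2 !word_perm_rcons uv -!mulrA; congr (_ * _).
clearbody v; rewrite !point_permM2 !point_permM !mulrA.
apply: (@phi_braid k l (fun i => x (v i)) lk); do ?exact: x0.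
- by apply: xD; rewrite (inj_eq perm_inj) -val_eqE /= lk; lia.
- by apply: xD; rewrite (inj_eq perm_inj) lo_neq_hi.
- by apply: xD; rewrite (inj_eq perm_inj) -val_eqE /= lk; lia.
Qed.

Lemma bracket_q : q != 1 -> bracket q q = 1.
Proof. by move=> q1; rewrite /bracket divff // subr_eq0 eq_sym. Qed.

Lemma hT1_sqr k : (T k + 1) * (T k + 1) = (q + 1) *: (T k + 1).
Proof.
have {1}-> : T k + 1 = (T k - q%:A) + (q + 1)%:A.
  by rewrite scalerDl scale1r addrA subrK.
by rewrite mulrDl hT_quadratic add0r mulr_algl.
Qed.

(** Right multiplication by [T k] acts on multiples of [T k + 1] as the scalar
    q. *)
Lemma hT1_shift k (c : K) : (T k + 1) * (T k + c%:A) = (q + c) *: (T k + 1).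
Proof.
have -> : T k + c%:A = (T k + 1) + (c - 1)%:A.
  by rewrite scalerBl scale1r addrACA subrr addr0.
by rewrite mulrDr hT1_sqr mulr_algr -scalerDl; congr (_ *: _); ring.
Qed.

(** The bracket of b / a has a pole at a = b. On the left-hand side it is
    multiplied by q + <b / (q a)>, because of [hT1_shift], and the numerator of
    that scalar is a multiple of a - b. *)
Lemma fusion k (B : H) (a b : K) : q != 0 -> a != 0 -> a != b -> q * a != b ->
  (T k + 1) * (B + (bracket q (b / a))%:A) * (T k + (bracket q (b / (q * a)))%:A) =
  (T k + 1) * (B * (T k + (bracket q (b / (q * a)))%:A) + (bracket q (b / (q * a)))%:A).
Proof.
move=> q0 a0 ab qab; set y := bracket q (b / (q * a)).
rewrite [in LHS](mulrDr _ B) mulrDl mulr_algr -scalerAl hT1_shift scalerA.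
rewrite [in RHS]mulrDr [in RHS]mulrA; congr (_ + _).
rewrite mulr_algr; congr (_ *: _); rewrite /y !bracketE ?mulf_neq0 //.
by rewrite -subr_eq0 in ab; rewrite -subr_eq0 in qab; field; rewrite ab qab.
Qed.

Definition phi_perm w x : H := phi_word q (sval (cid (exists_reduced_word w))) x.

Lemma phi_permE s x : generic x -> reduced_word s ->
  phi_word q s x = phi_perm (word_perm s) x.
Proof.
move=> xg rs; rewrite /phi_perm; case: cid => t [rt ts] /=.
exact: phi_word_reduced.
Qed.

Lemma phi_perm1 x : generic x -> phi_perm 1%g x = 1.
Proof.
move=> xg; have w1 : word_perm [::] = 1%g :> 'S_n by rewrite /word_perm big_nil.
rewrite -w1 -phi_permE ?phi_word_nil //.
by rewrite /reduced_word w1 inversions1 cards0.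
Qed.

Lemma phi_perm_adj w k x : generic x -> ascent w k ->
  phi_perm (adj_transp k * w)%g x = phi_perm w x * phi q k (fun i => x (w i)).
Proof.
move=> xg asc; have [s [rs sw]] := exists_reduced_word w.
rewrite -sw -word_perm_rcons -!phi_permE ?phi_word_rcons //.
by rewrite reduced_word_rcons rs sw.
Qed.

(** Exchange the labels at positions k and k + 1 last. If they are neighbours
    in a row, the last factor is [T k + <q>] = [T k + 1], which is idempotent up
    to the scalar q + 1. *)
Lemma phi_perm_absorb w k x : generic x -> ~~ ascent w k -> q != 1 -> q + 1 != 0 ->
  x (w (lo k)) = q * x (w (hi k)) ->
  phi_perm w x = (q + 1)^-1 *: (phi_perm w x * (T k + 1)).
Proof.
move=> xg dsc q1 qp xq; rewrite -[w](adj_mulK k).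
have xw := proj2 xg (w (hi k)).
rewrite phi_perm_adj ?ascent_adj // /phi adj_lo adj_hi xq mulfK //.
by rewrite bracket_q // scale1r -mulrA hT1_sqr -scalerAr scalerA mulVf // scale1r.
Qed.
End YangBaxter.
(** * Rearranging sequences by crossings *)

Section Crossing.
Variables (T : Type) (R : seq T -> Prop).
Implicit Types (u v L : seq T).

(** Only the result counts: single letters of u and v need not cross each other
    within [R]. *)
Definition crosses u v := forall L1 L2,
  R (L1 ++ u ++ v ++ L2) -> R (L1 ++ v ++ u ++ L2).

Lemma crosses_catl u u' v : crosses u v -> crosses u' v -> crosses (u ++ u') v.
Proof.
move=> cu cu' L1 L2; rewrite -catA [in X in X -> _]catA => /cu'.
by rewrite -catA => /cu; rewrite -catA.
Qed.

Lemma crosses_catr u v v' : crosses u v -> crosses u v' -> crosses u (v ++ v').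
Proof.
move=> cv cv' L1 L2; rewrite -catA => /cv; rewrite [in X in X -> _]catA => /cv'.
by rewrite -!catA.
Qed.

Lemma crosses_nil u : crosses [::] u. Proof. by []. Qed.
Lemma crosses_nilr u : crosses u [::]. Proof. by []. Qed.
End Crossing.

Section CrossingRows.
Variables (T : eqType) (R : seq T -> Prop).
Implicit Types (u v L : seq T).
Local Notation crosses := (crosses R).

Lemma crosses_allr u v : (forall b, b \in v -> crosses u [:: b]) -> crosses u v.
Proof.
elim: v => [|b v IH] h; first exact: crosses_nilr.
rewrite -cat1s; apply: crosses_catr; first by apply: h; rewrite mem_head.
by apply: IH => c cv; apply: h; rewrite inE cv orbT.
Qed.

Lemma crosses_alll u v : (forall a, a \in u -> crosses [:: a] v) -> crosses u v.
Proof.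
elim: u => [|a u IH] h; first exact: crosses_nil.
rewrite -cat1s; apply: crosses_catl; first by apply: h; rewrite mem_head.
by apply: IH => c cv; apply: h; rewrite inE cv orbT.
Qed.

(** The last letters are reversed first, and then the first letter crosses all
    of them. *)
Lemma reverse_letters u L1 L2 : pairwise (fun a b => `[< crosses [:: a] [:: b] >]) u ->
  R (L1 ++ u ++ L2) -> R (L1 ++ rev u ++ L2).
Proof.
elim: u L1 L2 => // a u IH L1 L2; rewrite pairwise_cons => /andP[/allP au pu].
rewrite -cat1s -catA catA => /IH-/(_ pu); rewrite -catA rev_cat -catA.
apply: crosses_allr => b; rewrite mem_rev => /au; exact: asboolW.
Qed.

Lemma reverse_blocks (bs : seq (seq T)) L1 L2 :
    (forall u, u \in bs -> pairwise (fun a b => `[< crosses [:: a] [:: b] >]) u) ->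
    pairwise (fun u v => `[< crosses (rev u) (rev v) >]) bs ->
  R (L1 ++ flatten bs ++ L2) -> R (L1 ++ rev (flatten bs) ++ L2).
Proof.
elim: bs L1 L2 => // u bs IH L1 L2 inner; rewrite pairwise_cons => /andP[/allP ub pb].
rewrite /= -catA catA => /IH-/(_ _ pb); rewrite -catA rev_cat -catA => h.
have /h {h} : forall v, v \in bs -> pairwise (fun a b => `[< crosses [:: a] [:: b] >]) v.
  by move=> v vb; apply: inner; rewrite inE vb orbT.
move=> /reverse_letters-/(_ (inner _ (mem_head _ _))).
suff : crosses (rev u) (rev (flatten bs)) by apply.
elim: bs ub {IH inner pb} => [|v bs IH] ub /=; first exact: crosses_nilr.
rewrite rev_cat; apply: crosses_catr.
  by apply: IH => v' vb; apply: ub; rewrite inE vb orbT.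
by apply: asboolW; apply: ub; rewrite mem_head.
Qed.
End CrossingRows.

Section CrossingIntervals.
Variable R : seq nat -> Prop.
Local Notation crosses := (crosses R).

(** A letter that cannot be crossed alone is crossed together with its successor:
    b meets the letters of the reversed interval in increasing order. *)
Lemma crosses_row_letter s m b :
    (forall a, (s <= a < s + m)%N -> crosses [:: a] [:: b] \/
       (a.+1 < s + m)%N /\ crosses [:: a.+1; a] [:: b]) ->
  crosses (rev (iota s m)) [:: b].
Proof.
have [k] := ubnP m; elim: k s m => // k IH s [|m] lem h; first exact: crosses_nil.
have [c|[sm c]] := h s ltac:(lia).
  rewrite /= rev_cons -cats1; apply: crosses_catl => //.
  apply: IH => // a am; have [|[]] := h a ltac:(lia); first by left.
  by right; split=> //; lia.
case: m lem h sm => [|m] lem h sm; first by lia.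
rewrite /= !rev_cons -!cats1 -catA; apply: crosses_catl => //.
apply: IH => [|a am]; first by lia.
have [|[]] := h a ltac:(lia); first by left.
by right; split=> //; lia.
Qed.

(** Here a meets the letters of the reversed interval in decreasing order, so
    the companion of b is its predecessor. *)
Lemma crosses_letter_row a t m :
    (forall b, (t <= b < t + m)%N -> crosses [:: a] [:: b] \/
       (t < b)%N /\ crosses [:: a] [:: b; b.-1]) ->
  crosses [:: a] (rev (iota t m)).
Proof.
have [k] := ubnP m; elim: k m => // k IH [|m] lem h; first exact: crosses_nilr.
rewrite -addn1 iotaD rev_cat.
have [c|[tm c]] := h (t + m)%N ltac:(lia).
  apply: crosses_catr => //; apply: IH => // b bm; apply: h; lia.
case: m lem h tm c => [|m] lem h tm c; first by lia.
rewrite -(addn1 m) iotaD rev_cat catA; apply: crosses_catr.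
  by move: c; rewrite -addn1 addnA addn1.
apply: IH => [|b bm]; first by lia.
by apply: h; lia.
Qed.
End CrossingIntervals.
(** * Regular functions at a point of a family *)

Section Regular.
Variables (K : fieldType) (n : nat) (D : ('I_n -> K) -> Prop) (p : 'I_n -> K).
Local Notation point := ('I_n -> K).

(** Here D is the set of points that count, the generic points of the family,
    and p need not belong to it. *)
Definition poly_fun (V : lmodType K) (N : point -> V) :=
  exists (m : nat) (P : 'I_m -> {mpoly K[n]}) (e : 'I_m -> V),
    forall x, N x = \sum_(j < m) (P j).@[x] *: e j.

Definition regular (V : lmodType K) (psi : point -> V) :=
  exists (Q : {mpoly K[n]}) (N : point -> V), [/\ poly_fun N, Q.@[p] != 0 &
    forall x, D x -> Q.@[x] *: psi x = N x].

Definition regular_scalar (g : point -> K) :=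
  exists Q A : {mpoly K[n]}, Q.@[p] != 0 /\
    forall x, D x -> Q.@[x] * g x = A.@[x].

Lemma poly_fun_fin (V : lmodType K) (I : finType) (P : I -> {mpoly K[n]}) (e : I -> V) :
  poly_fun (fun x => \sum_i (P i).@[x] *: e i).
Proof.
exists #|I|, (fun j => P (enum_val j)), (fun j => e (enum_val j)) => x.
by rewrite (reindex _ (onW_bij _ (@enum_val_bij I))).
Qed.

Lemma poly_fun_ext (V : lmodType K) (N N' : point -> V) :
  N =1 N' -> poly_fun N -> poly_fun N'.
Proof. by move=> E [m [P [e h]]]; exists m, P, e => x; rewrite -E. Qed.

Lemma poly_funD (V : lmodType K) (N N' : point -> V) :
  poly_fun N -> poly_fun N' -> poly_fun (fun x => N x + N' x).
Proof.
move=> [m [P [e h]]] [m' [P' [e' h']]].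
apply: (poly_fun_ext _ (@poly_fun_fin V ('I_m + 'I_m')%type
  (fun i => match i with inl j => P j | inr j => P' j end)
  (fun i => match i with inl j => e j | inr j => e' j end))).
by move=> x; rewrite big_sumType /= h h'.
Qed.

Lemma poly_funM (V : algType K) (N N' : point -> V) :
  poly_fun N -> poly_fun N' -> poly_fun (fun x => N x * N' x).
Proof.
move=> [m [P [e h]]] [m' [P' [e' h']]].
apply: (poly_fun_ext _ (@poly_fun_fin V ('I_m * 'I_m')%type
  (fun i => P i.1 * P' i.2) (fun i => e i.1 * e' i.2))).
move=> x; rewrite h h' big_distrlr /= pair_big /=; apply: eq_bigr => i _.
by rewrite mevalM -scalerAl -scalerAr scalerA.
Qed.

Lemma poly_fun_const (V : lmodType K) (v : V) : poly_fun (fun=> v).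
Proof.
apply: (poly_fun_ext _ (@poly_fun_fin V unit (fun=> 1) (fun=> v))).
by move=> x; rewrite big_const card_unit /= meval1 scale1r addr0.
Qed.

Lemma poly_funZ (V : lmodType K) (A : {mpoly K[n]}) (N : point -> V) :
  poly_fun N -> poly_fun (fun x => A.@[x] *: N x).
Proof.
move=> [m [P [e h]]]; exists m, (fun j => A * P j), e => x.
by rewrite h scaler_sumr; apply: eq_bigr => j _; rewrite mevalM scalerA.
Qed.

Lemma regular_ext (V : lmodType K) (f g : point -> V) :
  (forall x, D x -> f x = g x) -> regular f -> regular g.
Proof.
by move=> E [Q [N [pN Q0 h]]]; exists Q, N; split=> // x Dx; rewrite -E // h.
Qed.

Lemma regular_const (V : lmodType K) (v : V) : regular (fun=> v).
Proof.
exists 1, (fun=> v); split; first exact: poly_fun_const.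
  by rewrite meval1 oner_neq0.
by move=> x _; rewrite meval1 scale1r.
Qed.

Lemma regularD (V : lmodType K) (f g : point -> V) :
  regular f -> regular g -> regular (fun x => f x + g x).
Proof.
move=> [Q [N [pN Q0 h]]] [Q' [N' [pN' Q0' h']]].
exists (Q * Q'), (fun x => Q'.@[x] *: N x + Q.@[x] *: N' x); split.
- by apply: poly_funD; apply: poly_funZ.
- by rewrite mevalM mulf_neq0.
move=> x Dx; rewrite -h // -h' // mevalM scalerDr !scalerA.
by rewrite (mulrC Q'.@[x]).
Qed.

Lemma regularM (V : algType K) (f g : point -> V) :
  regular f -> regular g -> regular (fun x => f x * g x).
Proof.
move=> [Q [N [pN Q0 h]]] [Q' [N' [pN' Q0' h']]].
exists (Q * Q'), (fun x => N x * N' x); split.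
- exact: poly_funM.
- by rewrite mevalM mulf_neq0.
by move=> x Dx; rewrite -h // -h' // mevalM -scalerAl -scalerAr scalerA.
Qed.

Lemma regularZ (V : lmodType K) (g : point -> K) (f : point -> V) :
  regular_scalar g -> regular f -> regular (fun x => g x *: f x).
Proof.
move=> [Q [A [Q0 h]]] [Q' [N' [pN' Q0' h']]].
exists (Q * Q'), (fun x => A.@[x] *: N' x); split.
- exact: poly_funZ.
- by rewrite mevalM mulf_neq0.
by move=> x Dx; rewrite -h // -h' // mevalM !scalerA mulrAC.
Qed.

Lemma regular_frac (A B : {mpoly K[n]}) (g : point -> K) : B.@[p] != 0 ->
  (forall x, D x -> B.@[x] != 0 /\ g x = A.@[x] / B.@[x]) -> regular_scalar g.
Proof.
move=> B0 h; exists B, A; split=> // x /h[Bx ->].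
by rewrite mulrC divfK.
Qed.

Lemma regular_scalar_const c : regular_scalar (fun=> c).
Proof.
by exists 1, c%:MP; rewrite meval1 oner_neq0; split=> // x _; rewrite meval1 mul1r mevalC.
Qed.
End Regular.
(** * Fusion of two exchanges *)

Section FusionSteps.
Variables (K : fieldType) (q : K) (n : nat).
Hypotheses (q0 : q != 0) (q1 : q != 1) (qp : q + 1 != 0).
Implicit Types (w : 'S_n) (k l : 'I_n.-1) (x : 'I_n -> K).
Local Notation T := (hT q).

(** [fusion] after [phi_perm_absorb]: the factor [T k + 1] produced by the
    descent is used and then absorbed again. *)
Lemma phi_perm_fusion w k (B : hecke q n.-1) x (a b : K) :
    generic x -> ~~ ascent w k -> x (w (lo k)) = q * x (w (hi k)) ->
    a != 0 -> a != b -> q * a != b ->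
  let y := bracket q (b / (q * a)) in
  phi_perm q w x * (B + (bracket q (b / a))%:A) * (T k + y%:A) =
  phi_perm q w x * (B * (T k + y%:A) + y%:A).
Proof.
move=> xg dsc xq a0 ab qab y; rewrite (phi_perm_absorb xg dsc q1 qp xq).
rewrite -!scalerAl -![phi_perm q w x * _ * _]mulrA; congr (_ *: _).
by rewrite -!mulrA; congr (_ * _); rewrite mulrA; exact: fusion.
Qed.

(** From the arrangement a', a, b, with a' the right neighbour of a, the label b
    crosses a and then a'. Only the bracket for a' and b is left. *)
Lemma phi_perm_fuse_row_letter w k l x : generic x -> l = k.+1 :> nat ->
    ~~ ascent w k -> ascent w l -> (w (lo k) < w (hi l))%N ->
    x (w (lo k)) = q * x (w (lo l)) ->
  let y := bracket q (x (w (hi l)) / x (w (lo k))) in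
  phi_perm q (adj_transp k * (adj_transp l * w))%g x =
  phi_perm q w x * (T l * (T k + y%:A) + y%:A).
Proof.
move=> xg lk dk al akl xq y; have [xI x0] := xg.
have xn (i j : 'I_n) : (i < j)%N -> x i != x j.
  by move=> ij; rewrite (inj_eq xI) -val_eqE neq_ltn ij.
rewrite phi_perm_adj //; last by rewrite /ascent !permM !(adj_nextE lk).
rewrite phi_perm_adj // /phi !permM !(adj_nextE lk) /y xq.
apply: phi_perm_fusion => //; rewrite ?(adj_nextE lk) //; first exact: xn.
by rewrite -xq; exact: xn.
Qed.

(** From the arrangement a, b', b, with b' the right neighbour of b, the label a
    crosses b' and then b. Only the bracket for a and b is left. *)
Lemma phi_perm_fuse_letter_row w k l x : generic x -> l = k.+1 :> nat ->
    ~~ ascent w l -> ascent w k -> (w (lo k) < w (hi l))%N ->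
    x (w (lo l)) = q * x (w (hi l)) ->
  let y := bracket q (x (w (hi l)) / x (w (lo k))) in
  phi_perm q (adj_transp l * (adj_transp k * w))%g x =
  phi_perm q w x * (T k * (T l + y%:A) + y%:A).
Proof.
move=> xg lk dl ak akl xq y; have [xI x0] := xg.
have xn (i j : 'I_n) : (i < j)%N -> x i != x j.
  by move=> ij; rewrite (inj_eq xI) -val_eqE neq_ltn ij.
rewrite phi_perm_adj //; last by rewrite /ascent !permM !(adj_nextE lk).
rewrite phi_perm_adj // /phi !permM !(adj_nextE lk) /y.
have -> : x (w (hi l)) / x (w (lo k)) = x (w (lo l)) / (q * x (w (lo k))).
  by rewrite xq invfM mulrACA divff // mul1r.
apply: phi_perm_fusion => //; first by apply: xn; rewrite /ascent (hi_lo lk) in ak.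
by rewrite xq (inj_eq (mulfI q0)); exact: xn.
Qed.
End FusionSteps.
(** * Arrangements reached by regular products *)

Section RegularArrangements.
Variables (K : fieldType) (q : K) (n : nat).
Variables (D : ('I_n -> K) -> Prop) (p : 'I_n -> K) (dp : rel 'I_n).
Hypotheses (q0 : q != 0) (q1 : q != 1) (qp : q + 1 != 0).
Hypotheses (Dgen : forall x, D x -> generic x) (p0 : forall i, p i != 0).
Implicit Types (w : 'S_n) (k l : 'I_n.-1) (x : 'I_n -> K) (a b : 'I_n).
Local Notation T := (hT q).
Local Notation regular := (regular D p).
Local Notation regular_scalar := (regular_scalar D p).

(** The factors of delta are distributed over the exchanges: the exchange of a
    pair in [dp] is multiplied by the factor that belongs to the pair. *)
Definition crossing_factor a b x := if dp a b then 1 - x b / x a else 1.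

Definition crossed_delta w x :=
  \prod_(ab in inversions w) crossing_factor ab.1 ab.2 x.

Definition regular_perm w :=
  regular (fun x => crossed_delta w x *: phi_perm q w x).

Lemma crossed_delta_adj w k x : ascent w k ->
  crossed_delta (adj_transp k * w)%g x =
  crossing_factor (w (lo k)) (w (hi k)) x * crossed_delta w x.
Proof.
by move=> asc; rewrite /crossed_delta inversions_adj // big_setU1 // inversions_adj_notin.
Qed.

Lemma regular_scalar_crossing a b : regular_scalar (crossing_factor a b).
Proof.
rewrite /crossing_factor; case: (dp a b); last exact: regular_scalar_const.
apply: (@regular_frac _ _ _ _ ('X_a - 'X_b) 'X_a); first by rewrite mevalXU.
move=> x /Dgen[_ x0]; rewrite mevalB !mevalXU; split=> //.
by rewrite mulrBl divff.
Qed.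

Lemma regular_bracket a b : p a != p b -> a != b ->
  regular_scalar (fun x => bracket q (x b / x a)).
Proof.
move=> pab ab; apply: (@regular_frac _ _ _ _ ((1 - q)%:MP * 'X_a) ('X_a - 'X_b)).
  by rewrite mevalB !mevalXU subr_eq0.
move=> x /Dgen[xI x0]; rewrite mevalB mevalM mevalC !mevalXU subr_eq0 (inj_eq xI).
by rewrite bracketE.
Qed.

Lemma regular_algebra_scalar g : regular_scalar g ->
  regular (fun x => (g x)%:A : hecke q n.-1).
Proof. by move=> rg; apply: regularZ => //; exact: regular_const. Qed.

Lemma regular_perm1 : regular_perm 1%g.
Proof.
apply: (@regular_ext _ _ _ _ _ (fun=> 1)); last exact: regular_const.
move=> x /Dgen xg; rewrite phi_perm1 // /crossed_delta inversions1 big_set0.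
by rewrite scale1r.
Qed.

(** An exchange without pole, or with a simple pole cancelled by a factor of
    delta. *)
Lemma regular_perm_adj w k : ascent w k ->
    p (w (lo k)) != p (w (hi k)) \/ dp (w (lo k)) (w (hi k)) ->
  regular_perm w -> regular_perm (adj_transp k * w)%g.
Proof.
move=> asc good rw; set a := w (lo k) in good *; set b := w (hi k) in good *.
have ab : a != b by rewrite (inj_eq perm_inj) lo_neq_hi.
have rf : regular (fun x => crossing_factor a b x *: (T k + (bracket q (x b / x a))%:A)).
  case: good => [pab|dab].
    apply: regularZ; first exact: regular_scalar_crossing.
    by apply: regularD; [exact: regular_const|exact/regular_algebra_scalar/regular_bracket].
  apply: (@regular_ext _ _ _ _ _
    (fun x => crossing_factor a b x *: T k + (1 - q)%:A)) => [x /Dgen[xI x0]|].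
    rewrite /crossing_factor dab scalerDr scalerA /bracket (mulrC _ ((1 - q) / _)) divfK //.
    have -> : 1 - x b / x a = (x a - x b) / x a by rewrite mulrBl divff.
    by rewrite mulf_neq0 ?invr_eq0 // subr_eq0 (inj_eq xI).
  apply: regularD; last exact: regular_const.
  by apply: regularZ; [exact: regular_scalar_crossing|exact: regular_const].
apply: (regular_ext _ (regularM rw rf)) => x /Dgen xg.
rewrite crossed_delta_adj // phi_perm_adj // -/a -/b /phi.
by rewrite -scalerAl -scalerAr scalerA mulrC.
Qed.

Lemma regular_fused (g : ('I_n -> K) -> K) A B :
  regular_scalar g ->
  regular (fun x => A * (B + (g x)%:A) + (g x)%:A : hecke q n.-1).
Proof.
move=> rg; have rA := regular_algebra_scalar rg; apply: regularD => //.
apply: regularM; first exact: regular_const.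
by apply: regularD => //; exact: regular_const.
Qed.

(** The exchange of the second and third labels may be singular on its own. *)
Lemma regular_perm_row_letter w k l : l = k.+1 :> nat ->
    ~~ ascent w k -> ascent w l -> (w (lo k) < w (hi l))%N ->
    (forall x, D x -> x (w (lo k)) = q * x (w (lo l))) ->
    p (w (lo k)) != p (w (hi l)) ->
  regular_perm w -> regular_perm (adj_transp k * (adj_transp l * w))%g.
Proof.
move=> lk dk al akl link pab rw.
have ak : ascent (adj_transp l * w)%g k by rewrite /ascent !permM !(adj_nextE lk).
have ab : w (lo k) != w (hi l) by rewrite -val_eqE neq_ltn akl.
have rf := regular_fused (T l) (T k) (regular_bracket pab ab).
apply: (regular_ext _ (regularZ (regular_scalar_crossing (w (lo k)) (w (hi l)))
  (regularZ (regular_scalar_crossing (w (lo l)) (w (hi l))) (regularM rw rf)))).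
move=> x Dx; have xg := Dgen Dx.
rewrite !crossed_delta_adj // !permM !(adj_nextE lk).
by rewrite phi_perm_fuse_row_letter ?link // -scalerAl !scalerA !mulrA.
Qed.

Lemma regular_perm_letter_row w k l : l = k.+1 :> nat ->
    ~~ ascent w l -> ascent w k -> (w (lo k) < w (hi l))%N ->
    (forall x, D x -> x (w (lo l)) = q * x (w (hi l))) ->
    p (w (lo k)) != p (w (hi l)) ->
  regular_perm w -> regular_perm (adj_transp l * (adj_transp k * w))%g.
Proof.
move=> lk dl ak akl link pab rw.
have al : ascent (adj_transp k * w)%g l by rewrite /ascent !permM !(adj_nextE lk).
have ab : w (lo k) != w (hi l) by rewrite -val_eqE neq_ltn akl.
have rf := regular_fused (T k) (T l) (regular_bracket pab ab).
apply: (regular_ext _ (regularZ (regular_scalar_crossing (w (lo k)) (w (hi l)))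
  (regularZ (regular_scalar_crossing (w (lo k)) (w (lo l))) (regularM rw rf)))).
move=> x Dx; have xg := Dgen Dx.
rewrite !crossed_delta_adj // !permM !(adj_nextE lk).
by rewrite phi_perm_fuse_letter_row ?link // -scalerAl !scalerA !mulrA.
Qed.

Definition arrangement w : seq nat := [seq (w i : nat) | i <- enum 'I_n].

Definition regular_arrangement L := exists w, arrangement w = L /\ regular_perm w.

Lemma nth_arrangement w (i : 'I_n) : nth 0%N (arrangement w) i = w i.
Proof. by rewrite (nth_map i) ?size_enum_ord // nth_ord_enum. Qed.

Lemma arrangement_swap w (L1 L2 : seq nat) (a b : nat) : arrangement w = L1 ++ a :: b :: L2 ->
  exists k, [/\ k = size L1 :> nat, w (lo k) = a :> nat, w (hi k) = b :> nat &
    arrangement (adj_transp k * w)%g = L1 ++ b :: a :: L2].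
Proof.
move=> E; have sz : n = (size L1 + (size L2).+2)%N.
  by have := congr1 size E; rewrite size_map size_enum_ord size_cat /=.
have hk : (size L1 < n.-1)%N by rewrite sz; lia.
pose k := Ordinal hk; exists k.
have wa : w (lo k) = a :> nat by rewrite -nth_arrangement E nth_cat /= ltnn subnn.
have wb : w (hi k) = b :> nat.
  by rewrite -nth_arrangement E nth_cat /= ltnNge leqnSn subSnn.
split=> //; apply: (@eq_from_nth _ 0%N).
  by rewrite size_map size_enum_ord size_cat /= {1}sz.
move=> i; rewrite size_map size_enum_ord => lti.
pose o := Ordinal lti; have -> : i = o by [].
rewrite nth_arrangement permM.
have [ek|nk] := eqVneq o (lo k).
  by rewrite ek adj_at_lo wb nth_cat /= ltnn subnn.
have [eh|nh] := eqVneq o (hi k).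
  by rewrite eh adj_at_hi wa nth_cat /= ltnNge leqnSn subSnn.
rewrite adj_fix // -nth_arrangement E !nth_cat /=; case: ltnP => // le.
move: nk nh; rewrite -!val_eqE /=.
by case: (i - size L1)%N (subnK le) => [|[|d]] //= <-; rewrite ?add0n ?add1n eqxx.
Qed.

Local Notation crosses := (crosses regular_arrangement).

Lemma crosses_letters (a b : nat) : (a < b)%N ->
    (forall i j : 'I_n, i = a :> nat -> j = b :> nat -> p i != p j \/ dp i j) ->
  crosses [:: a] [:: b].
Proof.
move=> ab good L1 L2 [w [aw rw]]; have [k [_ wa wb aw']] := arrangement_swap aw.
exists (adj_transp k * w)%g; split=> //; apply: regular_perm_adj => //.
- by rewrite /ascent wa wb.
- exact: good.
Qed.

Lemma crosses_row_pair_letter (a b : nat) : (a.+1 < b)%N ->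
    (forall i i' : 'I_n, i = a :> nat -> i' = a.+1 :> nat ->
      forall x, D x -> x i' = q * x i) ->
    (forall i' j : 'I_n, i' = a.+1 :> nat -> j = b :> nat -> p i' != p j) ->
  crosses [:: a.+1; a] [:: b].
Proof.
move=> ab link pn L1 L2 [w [aw rw]].
have [k [kE wa' wa _]] := arrangement_swap aw.
have [l [lE _ wb aw1]] := @arrangement_swap w (rcons L1 a.+1) L2 a b
   (etrans aw (esym (cat_rcons _ _ _))).
have lk : l = k.+1 :> nat by rewrite lE kE size_rcons.
have [k' [kE' _ _ aw2]] := @arrangement_swap _ L1 (a :: L2) a.+1 b
   (etrans aw1 (cat_rcons _ _ _)).
have kk : k' = k by apply: val_inj; rewrite /= kE kE'.
rewrite {k' kE'}kk (hi_lo lk) in aw2 wa.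
exists (adj_transp k * (adj_transp l * w))%g; split=> //.
apply: regular_perm_row_letter => //.
- by rewrite not_ascent (hi_lo lk) wa wa'.
- by rewrite /ascent wa wb; lia.
- by rewrite wa' wb.
- exact: link.
- exact: pn.
Qed.

Lemma crosses_letter_row_pair (a b : nat) : (a < b)%N ->
    (forall j j' : 'I_n, j = b :> nat -> j' = b.+1 :> nat ->
      forall x, D x -> x j' = q * x j) ->
    (forall i j : 'I_n, i = a :> nat -> j = b :> nat -> p i != p j) ->
  crosses [:: a] [:: b.+1; b].
Proof.
move=> ab link pn L1 L2 [w [aw rw]].
have [k [kE wa wb' aw1]] := arrangement_swap aw.
have [l [lE _ wb _]] := @arrangement_swap w (rcons L1 a) L2 b.+1 b
   (etrans aw (esym (cat_rcons _ _ _))).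
have lk : l = k.+1 :> nat by rewrite lE kE size_rcons.
have [l' [lE' _ _ aw2]] := @arrangement_swap _ (rcons L1 b.+1) L2 a b
   (etrans aw1 (esym (cat_rcons _ _ _))).
have ll : l' = l by apply: val_inj; rewrite /= lE lE' !size_rcons.
rewrite {l' lE'}ll cat_rcons in aw2.
exists (adj_transp l * (adj_transp k * w))%g; split=> //.
rewrite (hi_lo lk) in wb'.
apply: regular_perm_letter_row => //.
- by rewrite not_ascent wb wb'.
- by rewrite /ascent (hi_lo lk) wa wb'; lia.
- by rewrite wa wb.
- exact: link.
- exact: pn.
Qed.
End RegularArrangements.
(** * The action of the Hecke algebra on words *)

Section WordAction.
Variables (K : fieldType) (q : K) (n : nat).
Local Notation word := ('I_n -> nat).
Implicit Types (k l : 'I_n.-1) (v : word) (f : word -> K).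

Definition swap_word k v : word := fun i => v (adj_transp k i).

(** The transpose of the R-matrix of type A. At equal letters, [swap_word k v]
    is v and the operator is multiplication by q. *)
Definition word_op k f v : K :=
  if (v (lo k) < v (hi k))%N then q * f (swap_word k v)
  else (q - 1) * f v + f (swap_word k v).

Lemma swap_wordK k v : swap_word k (swap_word k v) = v.
Proof. by apply/funext => i; rewrite /swap_word tpermK. Qed.

Lemma swap_word_lo k v : swap_word k v (lo k) = v (hi k).
Proof. by rewrite /swap_word adj_at_lo. Qed.

Lemma swap_word_hi k v : swap_word k v (hi k) = v (lo k).
Proof. by rewrite /swap_word adj_at_hi. Qed.

Lemma word_op_sum k (I : Type) (r : seq I) (c : I -> K) (f : I -> word -> K) v :
  word_op k (fun v => \sum_(i <- r) c i * f i v) v =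
  \sum_(i <- r) c i * word_op k (f i) v.
Proof.
rewrite /word_op; case: ifP => _; first by rewrite mulr_sumr; apply: eq_bigr => i _; ring.
by rewrite mulr_sumr -big_split; apply: eq_bigr => i _ /=; ring.
Qed.

Lemma word_op_lin k c (f g : word -> K) v :
  word_op k (fun v => f v - c * g v) v = word_op k f v - c * word_op k g v.
Proof. by rewrite /word_op; case: ifP => _; ring. Qed.

Lemma word_op_quadratic k f v :
  word_op k (word_op k f) v = (q - 1) * word_op k f v + q * f v.
Proof.
rewrite /word_op swap_wordK swap_word_lo swap_word_hi.
have [vlt|vgt|veq] := ltngtP (v (lo k)) (v (hi k)); try by ring.
have -> : swap_word k v = v; last by ring.
apply/funext => i; rewrite /swap_word.
have [->|il] := eqVneq i (lo k); first by rewrite adj_at_lo veq.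
have [->|ih] := eqVneq i (hi k); first by rewrite adj_at_hi veq.
by rewrite adj_fix.
Qed.

Lemma word_op_commute k l f v : (k.+1 < l)%N ->
  word_op k (word_op l f) v = word_op l (word_op k f) v.
Proof.
move=> kl; rewrite /word_op.
have -> : swap_word k (swap_word l v) = swap_word l (swap_word k v).
  by apply/funext=> i; rewrite /swap_word -!permM adj_commute.
rewrite /swap_word !adj_fix /=; try lia.
by case: ifP => _; case: ifP => _; ring.
Qed.

Section LocalBraid.
Implicit Type F : nat -> nat -> nat -> K.
Let op12 F a b c := if (a < b)%N then q * F b a c else (q - 1) * F a b c + F b a c.
Let op23 F a b c := if (b < c)%N then q * F a c b else (q - 1) * F a b c + F a c b.

(** The braid relation involves three positions only, and for them it is a
    finite verification over the relative orders of the three letters. *)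
Lemma three_letter_braid F a b c :
  op12 (op23 (op12 F)) a b c = op23 (op12 (op23 F)) a b c.
Proof.
rewrite /op12 /op23.
case: (ltngtP a b) => ab; case: (ltngtP b c) => bc; case: (ltngtP a c) => ac;
  try (exfalso; lia); try subst b; try subst c; rewrite ?ltnn; ring.
Qed.

Lemma word_op_braid k l f v : l = k.+1 :> nat ->
  word_op k (word_op l (word_op k f)) v = word_op l (word_op k (word_op l f)) v.
Proof.
move=> lk.
have d1 : (lo l == lo k) = false by apply/eqP=> /(congr1 val) /=; lia.
have d2 : (hi l == lo k) = false by apply/eqP=> /(congr1 val) /=; lia.
have d3 : (hi l == lo l) = false by apply/eqP=> /(congr1 val) /=; lia.
(* the word v with its letters at the three positions replaced *)
pose W a b c : word := fun i => if i == lo k then a else if i == lo l then b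
  else if i == hi l then c else v i.
have W1 a b c : W a b c (lo k) = a by rewrite /W eqxx.
have W2 a b c : W a b c (lo l) = b by rewrite /W d1 eqxx.
have W3 a b c : W a b c (hi l) = c by rewrite /W d2 d3 eqxx.
have W0 a b c i : i != lo k -> i != lo l -> i != hi l -> W a b c i = v i.
  by move=> /negPf i1 /negPf i2 /negPf i3; rewrite /W i1 i2 i3.
have Wk a b c : swap_word k (W a b c) = W b a c.
  apply/funext => i; rewrite /swap_word.
  have [->|i1] := eqVneq i (lo k); first by rewrite adj_at_lo (hi_lo lk) W1 W2.
  have [->|i2] := eqVneq i (lo l); first by rewrite (adj_nextE lk) W1 W2.
  rewrite adj_fix //; last by rewrite -lk.
  have [->|i3] := eqVneq i (hi l); first by rewrite !W3.
  by rewrite !W0.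
have Wl a b c : swap_word l (W a b c) = W a c b.
  apply/funext => i; rewrite /swap_word.
  have [->|i1] := eqVneq i (lo l); first by rewrite adj_at_lo W2 W3.
  have [->|i2] := eqVneq i (hi l); first by rewrite adj_at_hi W2 W3.
  rewrite adj_fix //.
  have [->|i3] := eqVneq i (lo k); first by rewrite !W1.
  by rewrite !W0.
have opk g : (fun a b c => word_op k g (W a b c)) = op12 (fun a b c => g (W a b c)).
  by do 3![apply/funext => ?]; rewrite /word_op /op12 Wk W1 (hi_lo lk) W2.
have opl g : (fun a b c => word_op l g (W a b c)) = op23 (fun a b c => g (W a b c)).
  by do 3![apply/funext => ?]; rewrite /word_op /op23 Wl W2 W3.
have -> : v = W (v (lo k)) (v (lo l)) (v (hi l)).
  by apply/funext => i; rewrite /W; do 3![case: eqP => [->//|_]].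
move: (v (lo k)) (v (lo l)) (v (hi l)) => a b c.
have := three_letter_braid (fun a b c => f (W a b c)) a b c.
by rewrite -opk -opl -opk -opl -opk -opl.
Qed.
End LocalBraid.

Definition word_act (s : seq 'I_n.-1) f : word -> K :=
  foldl (fun f k => word_op k f) f s.

Lemma word_act_sum s (I : Type) (r : seq I) (c : I -> K) (f : I -> word -> K) :
  word_act s (fun v => \sum_(i <- r) c i * f i v) =
  fun v => \sum_(i <- r) c i * word_act s (f i) v.
Proof.
elim: s f => //= k s IH f; rewrite -IH; congr word_act.
by apply/funext => v; rewrite word_op_sum.
Qed.

Section Free.
Import monalg.
Local Notation freealg := {malg K[{fmonom 'I_n.-1}]}.

(** A monomial acts by its letters from left to right, so that this is a right
    action. *)
Definition free_act (g : freealg) f v : K :=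
  mmap idfun (fun s : {fmonom 'I_n.-1} => word_act s f v) g.

Lemma free_actD g h f v : free_act (g + h) f v = free_act g f v + free_act h f v.
Proof. exact: mmapD. Qed.

Lemma free_actB g h f v : free_act (g - h) f v = free_act g f v - free_act h f v.
Proof. exact: mmapB. Qed.

Lemma free_actU c s f v :
  free_act (mkmalgU s c : freealg) f v = c * word_act s f v.
Proof. by rewrite /free_act mmapU. Qed.

Lemma free_actM g h f : free_act (g * h) f = free_act h (free_act g f).
Proof.
apply/funext => v; rewrite /free_act malgME raddf_sum /= [RHS]mmapE.
under [RHS]eq_bigr => s _ do rewrite word_act_sum mulr_sumr.
rewrite exchange_big /=; apply: eq_bigr => s _.
rewrite raddf_sum /=; apply: eq_bigr => t _.
rewrite mmapU /= fmM /word_act foldl_cat; ring.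
Qed.

Lemma free_act_gen k f : free_act (gen K k) f = word_op k f.
Proof. by apply/funext => v; rewrite /gen free_actU fmU mul1r. Qed.

Lemma free_act_scalar c f v : free_act c%:A f v = c * f v.
Proof. by rewrite -mul_malgC mulr1 free_actU fm1. Qed.

Lemma free_act1 f v : free_act 1 f v = f v.
Proof. by have := free_act_scalar 1 f v; rewrite scale1r mul1r. Qed.

Lemma free_act0 g : free_act g (fun=> 0) = (fun=> 0).
Proof.
have E s : word_act s (fun=> 0) = (fun=> 0).
  have := word_act_sum s [::] (fun _ : nat => 0) (fun _ _ => 0).
  under eq_fun do rewrite big_nil; under [in RHS]eq_fun do rewrite big_nil.
  by [].
apply/funext => v; rewrite /free_act mmapE big1 // => s _.
by rewrite E mulr0.
Qed.

Lemma free_act_gen2 k l f :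
  free_act (gen K k * gen K l) f = word_op l (word_op k f).
Proof. by rewrite (free_actM (gen K k)) (free_act_gen k) (free_act_gen l). Qed.

Lemma free_act_gen3 k l j f :
  free_act (gen K k * gen K l * gen K j) f = word_op j (word_op l (word_op k f)).
Proof.
by rewrite (free_actM (gen K k * gen K l)) (free_act_gen2 k l) (free_act_gen j).
Qed.

Lemma free_act_relator g : hecke_relator q g -> forall f v, free_act g f v = 0.
Proof.
case=> [k l lk|k l kl|k] f v.
- apply: etrans (free_actB (gen K k * gen K l * gen K k) _ f v) _.
  apply/eqP; rewrite subr_eq0; apply/eqP.
  apply: etrans (congr1 (@^~ v) (free_act_gen3 k l k f)) _.
  apply: etrans (word_op_braid f v lk) _.
  exact: esym (congr1 (@^~ v) (free_act_gen3 l k l f)).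
- apply: etrans (free_actB (gen K k * gen K l) _ f v) _.
  apply/eqP; rewrite subr_eq0; apply/eqP.
  apply: etrans (congr1 (@^~ v) (free_act_gen2 k l f)) _.
  apply: etrans (esym (word_op_commute f v kl)) _.
  exact: esym (congr1 (@^~ v) (free_act_gen2 l k f)).
apply: etrans (congr1 (@^~ v) (free_actM (gen K k - q%:A) (gen K k + 1) f)) _.
apply: etrans (free_actD (gen K k) 1 _ v) _.
have E : free_act (gen K k - q%:A) f = fun v => word_op k f v - q * f v.
  apply/funext => u; apply: etrans (free_actB (gen K k) q%:A f u) _.
  by rewrite (free_act_gen k) free_act_scalar.
rewrite {}E free_act1 (free_act_gen k).
by rewrite word_op_lin word_op_quadratic; ring.
Qed.

Lemma free_act_ideal g : hecke_ideal q g -> forall f, free_act g f = (fun=> 0).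
Proof.
elim=> {g} [g hg f||g h _ IHg _ IHh f|g h _ IH f|g h _ IH f].
- by apply/funext => v; exact: free_act_relator.
- by move=> f; apply/funext => v; exact: mmap0.
- apply/funext => v; apply: etrans (free_actD g h f v) _.
  by rewrite IHg IHh addr0.
- by apply: etrans (free_actM g h f) _; exact: IH.
- by apply: etrans (free_actM g h f) _; rewrite IH; exact: free_act0.
Qed.

(** The ideal acts by 0, so the choice of a representative does not matter. *)
Definition hecke_act (h : hecke q n.-1) f : word -> K := free_act (generic_quotient.repr h) f.

Lemma hecke_act_pi g f : hecke_act (hpi q g) f = free_act g f.
Proof.
apply/funext => v; apply/eqP; rewrite -subr_eq0; apply/eqP.
apply: etrans (esym (free_actB (generic_quotient.repr (hpi q g)) g f v)) _.
have /free_act_ideal -> // : hecke_ideal q (generic_quotient.repr (hpi q g) - g).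
have /heckeIP := pi_repr q g => h; rewrite -opprB -mulN1r; exact: HMull.
Qed.

Lemma hpi_surj (h : hecke q n.-1) : exists g, h = hpi q g.
Proof. by elim/hecke_elim: h => g; exists g. Qed.

Lemma hecke_actD g h f v : hecke_act (g + h) f v = hecke_act g f v + hecke_act h f v.
Proof.
have [{}g ->] := hpi_surj g; have [{}h ->] := hpi_surj h.
rewrite (hecke_act_pi g) (hecke_act_pi h) -free_actD -(hecke_act_pi (g + h)).
by congr hecke_act; exact: esym (piD q g h).
Qed.

Lemma hecke_actM g h f : hecke_act (g * h) f = hecke_act h (hecke_act g f).
Proof.
have [{}g ->] := hpi_surj g; have [{}h ->] := hpi_surj h.
rewrite (hecke_act_pi g) (hecke_act_pi h) -free_actM -(hecke_act_pi (g * h)).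
by congr hecke_act; exact: esym (hpiM q g h).
Qed.

Lemma hecke_act_hT k f : hecke_act (hT q k) f = word_op k f.
Proof. by rewrite /hT hecke_act_pi (free_act_gen k). Qed.

Lemma hecke_act_scalar c f v : hecke_act c%:A f v = c * f v.
Proof.
have h1 : 1 = hpi q (1 : freealg) by [].
have -> : c%:A = hpi q (c *: (1 : freealg)) by rewrite h1; symmetry; exact: hpiZ.
exact: etrans (congr1 (@^~ v) (hecke_act_pi (c *: (1 : freealg)) f)) (free_act_scalar c f v).
Qed.

Lemma hecke_actZ c h f v : hecke_act (c *: h) f v = c * hecke_act h f v.
Proof. by rewrite -mulr_algr hecke_actM hecke_act_scalar. Qed.

Lemma hecke_act_sum (I : Type) (r : seq I) (h : I -> hecke q n.-1) f v :
  hecke_act (\sum_(i <- r) h i) f v = \sum_(i <- r) hecke_act (h i) f v.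
Proof.
apply: (big_morph (fun h => hecke_act h f v)) => [g h'|]; first exact: hecke_actD.
by rewrite -(scale0r 0) hecke_actZ mul0r.
Qed.
End Free.
End WordAction.
(** * The leading coefficient of phi_w *)

Section LeadingCoefficient.
Variables (K : fieldType) (q : K) (n : nat).
Local Notation word := ('I_n -> nat).
Implicit Types (w : 'S_n) (k l : 'I_n.-1) (s : seq 'I_n.-1) (u v : word)
  (x : 'I_n -> K).

Definition prefix_count v (i t : nat) : nat :=
  \sum_(j < n | (j < i)%N) (t <= v j)%N.

(** The Bruhat order on words, in terms of the numbers of large letters among
    the first i. *)
Definition dominated v u := forall i t, (prefix_count v i t <= prefix_count u i t)%N.

Lemma prefix_countS v (i : 'I_n) t :
  prefix_count v i.+1 t = (prefix_count v i t + (t <= v i))%N.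
Proof.
rewrite /prefix_count (bigD1 i) //= addnC; congr (_ + _)%N.
by apply: eq_bigl => j; rewrite ltnS -val_eqE /= andbC -ltn_neqAle.
Qed.

Lemma prefix_count_swap k v i t : i != k.+1 ->
  prefix_count (swap_word k v) i t = prefix_count v i t.
Proof.
move=> ik; rewrite /prefix_count (reindex_inj (@perm_inj _ (adj_transp k))) /=.
apply: eq_big => [j|j _]; last by rewrite /swap_word tpermK.
have [->|jl] := eqVneq j (lo k); first by rewrite adj_at_lo /=; lia.
have [->|jh] := eqVneq j (hi k); first by rewrite adj_at_hi /=; lia.
by rewrite adj_fix.
Qed.

Lemma prefix_count_lo k v t :
  prefix_count v k.+1 t = (prefix_count v k t + (t <= v (lo k)))%N.
Proof. exact: (prefix_countS v (lo k)). Qed.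

Lemma prefix_count_hi k v t : prefix_count v k.+2 t =
  (prefix_count v k t + (t <= v (lo k)) + (t <= v (hi k)))%N.
Proof. by rewrite (prefix_countS v (hi k)) prefix_count_lo. Qed.

(** The lifting property of the Bruhat order. Only the prefix of length k + 1
    changes; if the threshold exceeds both letters of u, this prefix of the
    swapped word counts as much as the prefix of length k + 2, and otherwise it
    counts one more than the prefix of length k. *)
Lemma dominated_swap k u v : (u (lo k) <= u (hi k))%N ->
  dominated v u \/ dominated (swap_word k v) u -> dominated v (swap_word k u).
Proof.
move=> uk; have lift i t : i != k.+1 ->
    dominated v u \/ dominated (swap_word k v) u ->
    (prefix_count v i t <= prefix_count u i t)%N.
  by move=> ik [|/(_ i t)] //; rewrite prefix_count_swap.
move=> dom i t; have [->{i}|ik] := eqVneq i k.+1; last first.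
  by rewrite prefix_count_swap //; exact: lift.
have := lift k t; have := lift k.+2 t; rewrite !prefix_count_hi.
rewrite !prefix_count_lo prefix_count_swap; last by lia.
rewrite swap_word_lo => /(_ ltac:(lia) dom) + /(_ ltac:(lia) dom); lia.
Qed.

Lemma not_dominated_swap k u : (u (lo k) < u (hi k))%N -> ~ dominated (swap_word k u) u.
Proof.
move=> uk /(_ k.+1 (u (hi k))); rewrite !prefix_count_lo prefix_count_swap; last by lia.
by rewrite swap_word_lo; lia.
Qed.

Variable g : word.
Hypothesis g_mono : forall i j : 'I_n, (i <= j)%N -> (g i <= g j)%N.

Definition spread_word w : word := fun i => g (w i).

Lemma spread_word_adj w k : spread_word (adj_transp k * w)%g = swap_word k (spread_word w).
Proof. by apply/funext => i; rewrite /spread_word /swap_word permM. Qed.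

Definition start_vector : word -> K := fun v => (`[< v = g >])%:R.

Definition word_coef s x : word -> K := hecke_act (phi_word q s x) start_vector.

Lemma word_coef_rcons s k x v : word_coef (rcons s k) x v =
  word_op q k (word_coef s x) v +
  bracket q (x (word_perm s (hi k)) / x (word_perm s (lo k))) * word_coef s x v.
Proof.
rewrite /word_coef phi_word_rcons hecke_actM /phi hecke_actD hecke_act_hT.
by rewrite hecke_act_scalar.
Qed.

Lemma word_coef_nil x : word_coef [::] x = start_vector.
Proof.
by apply/funext => v; rewrite /word_coef phi_word_nil -[1]scale1r hecke_act_scalar mul1r.
Qed.

Lemma word_perm_nil : word_perm [::] = 1%g :> 'S_n.
Proof. by rewrite /word_perm big_nil. Qed.

Lemma spread_word1 : spread_word 1%g = g.
Proof. by apply/funext => i; rewrite /spread_word perm1. Qed.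

(** Each factor T + <..> sends a word to combinations of itself and the word
    with two neighbours exchanged, so the support stays below the rearranged
    word. *)
Lemma word_coef_support s x v : reduced_word s -> word_coef s x v != 0 ->
  dominated v (spread_word (word_perm s)).
Proof.
elim/last_ind: s v => [|s k IH] v.
  rewrite word_coef_nil word_perm_nil spread_word1 /start_vector.
  move=> _; case: asboolP => [->|_]; last by rewrite eqxx.
  by move=> _ i t.
rewrite reduced_word_rcons => /andP[rs asc] nz.
rewrite word_perm_rcons spread_word_adj; apply: dominated_swap.
  by apply: g_mono; exact: ltnW.
have [z|] := eqVneq (word_coef s x v) 0; last by left; exact: IH.
right; apply: IH => //; apply: contraNneq nz => z'.
by rewrite word_coef_rcons /word_op z z' !mulr0 !addr0; case: ifP.
Qed.

(** When two labels with different letters are exchanged, the new leading word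
    was not in the support and gets its coefficient from the old one, by
    [not_dominated_swap]. When the letters are equal, the leading word does not
    change and T acts on it as q. *)
Lemma word_coef_leading s x : reduced_word s ->
  word_coef s x (spread_word (word_perm s)) =
  \prod_(ab in inversions (word_perm s))
    (if g ab.1 == g ab.2 then q + bracket q (x ab.2 / x ab.1) else 1).
Proof.
elim/last_ind: s => [_|s k IH].
  rewrite word_coef_nil word_perm_nil spread_word1 /start_vector inversions1 big_set0.
  by case: asboolP.
rewrite reduced_word_rcons => /andP[rs asc].
rewrite word_perm_rcons inversions_adj // big_setU1 ?inversions_adj_notin //=.
rewrite -{}IH // spread_word_adj word_coef_rcons; set w := word_perm s in asc *.
set u := spread_word w.
have uk : (u (lo k) <= u (hi k))%N by apply: g_mono; exact: ltnW.
rewrite -[g (w (lo k))]/(u (lo k)) -[g (w (hi k))]/(u (hi k)).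
rewrite /word_op swap_word_lo swap_word_hi ltnNge uk /= swap_wordK.
case: eqP => [E|/eqP E]; last first.
  have [->|/(word_coef_support rs) nd] := eqVneq (word_coef s x (swap_word k u)) 0.
    by rewrite !mulr0 add0r addr0 mul1r.
  by case: (@not_dominated_swap k u _ nd); rewrite ltn_neqAle E.
have -> : swap_word k u = u; last by ring.
apply/funext => i; rewrite /swap_word.
have [->|il] := eqVneq i (lo k); first by rewrite adj_at_lo E.
have [->|ih] := eqVneq i (hi k); first by rewrite adj_at_hi E.
by rewrite adj_fix.
Qed.
End LeadingCoefficient.
(** * Labels, rows and contents of a diagram *)

Section DiagramLabels.
Variable la : seq (int * int).
Local Notation row := Defs.row.

Definition row_length (r : int * int) : nat := absz (r.2 - r.1 + 1).
Definition row_lengths : seq nat := [seq row_length r | r <- la].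
Definition row_size (i : nat) : nat := nth 0%N row_lengths i.
(** Rows are numbered from 0 here, as labels are; the labels of row i are
    [offset i + j] for [j < row_size i]. *)
Definition offset (i : nat) : nat := sumn (take i row_lengths).

Definition first_content (i : nat) : int := (row la i.+1).1 - i.+1%:Z.
Definition last_content (i : nat) : int := (row la i.+1).2 - i.+1%:Z.

Definition box_at (k : nat) : nat * int := nth (0%N, 0) (boxes la) k.
Definition content_at (k : nat) : int := (box_at k).2 - (box_at k).1%:Z.

Definition blocks : seq (seq nat) :=
  [seq iota (offset i) (row_size i) | i <- iota 0 (size la)].

Lemma size_row_lengths : size row_lengths = size la.
Proof. exact: size_map. Qed.

Lemma sumn_row_lengths : sumn row_lengths = degree la.
Proof. by rewrite sumnE big_map. Qed.

Lemma offsetS i : (i < size la)%N -> offset i.+1 = (offset i + row_size i)%N.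
Proof.
move=> ir; rewrite /offset (take_nth 0%N) ?size_row_lengths //.
by rewrite sumn_rcons.
Qed.

Lemma offset_mono i i' : (i <= i')%N -> (offset i <= offset i')%N.
Proof.
elim: i' => [|i' IH]; first by rewrite leqn0 => /eqP->.
rewrite leq_eqVlt => /predU1P[->//|]; rewrite ltnS => /IH le.
apply: (leq_trans le); case: (ltnP i' (size la)) => [ir|ir].
  by rewrite offsetS // leq_addr.
by rewrite /offset !take_oversize ?size_row_lengths // ltnW.
Qed.

Lemma offset_size : offset (size la) = degree la.
Proof. by rewrite /offset -size_row_lengths take_size sumn_row_lengths. Qed.

Lemma block_before i i' : (i < i')%N -> (i < size la)%N ->
  (offset i + row_size i <= offset i')%N.
Proof. by move=> ii ir; rewrite -offsetS //; exact: offset_mono. Qed.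

Lemma label_lt i j : (i < size la)%N -> (j < row_size i)%N -> (offset i + j < degree la)%N.
Proof.
move=> ir jr; rewrite -offset_size; apply: leq_trans (block_before ir ir).
by rewrite ltn_add2l.
Qed.

Lemma flatten_blocks : flatten blocks = iota 0 (degree la).
Proof.
rewrite -offset_size /blocks; suff H r : (r <= size la)%N ->
    flatten [seq iota (offset i) (row_size i) | i <- iota 0 r] = iota 0 (offset r).
  exact: H.
elim: r => [_|r IH ltr]; first by rewrite /offset take0.
rewrite offsetS // iotaD -IH 1?ltnW // add0n -(addn1 r) iotaD map_cat flatten_cat.
by rewrite /= cats0.
Qed.

Lemma labelP k : (k < degree la)%N ->
  exists i j, [/\ (i < size la)%N, (j < row_size i)%N & k = (offset i + j)%N].
Proof.
rewrite -offset_size; elim: {1 3}(size la) (leqnn (size la)) => [|r IH] ltr.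
  by rewrite /offset take0.
rewrite offsetS // => kr; case: (ltnP k (offset r)) => [/(IH (ltnW ltr))//|kr'].
by exists r, (k - offset r)%N; split; lia.
Qed.

Lemma nth_flatten_offset (T : Type) (d : T) (ss : seq (seq T)) i j :
  (i < size ss)%N -> (j < size (nth [::] ss i))%N ->
  nth d (flatten ss) (sumn (take i (shape ss)) + j) = nth d (nth [::] ss i) j.
Proof.
elim: ss i => // s ss IH [|i] /= ir jr; first by rewrite add0n nth_cat jr.
by rewrite -addnA nth_cat ltnNge leq_addr /= addKn IH.
Qed.

Lemma box_atE i j : (i < size la)%N -> (j < row_size i)%N ->
  box_at (offset i + j) = (i.+1, (row la i.+1).1 + j%:Z).
Proof.
move=> ir jr; rewrite /box_at /boxes.
set ss := map _ _.
have szs : size ss = size la by rewrite size_map size_iota.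
have nths i' : (i' < size la)%N ->
    nth [::] ss i' = [seq (i'.+1, (row la i'.+1).1 + j%:Z) | j <- iota 0 (row_size i')].
  move=> ir'; rewrite (nth_map 0%N) ?size_iota // nth_iota // add1n.
  by rewrite /row_size (nth_map (0, 0)).
have sh : shape ss = row_lengths.
  apply: (@eq_from_nth _ 0%N); rewrite ?size_map ?size_iota // => i' ir'.
  by rewrite (nth_map [::]) ?szs // nths // size_map size_iota.
rewrite /offset -sh nth_flatten_offset ?szs //; rewrite nths ?size_map ?size_iota //.
by rewrite (nth_map 0%N) ?size_iota // nth_iota.
Qed.

Lemma content_atE i j : (i < size la)%N -> (j < row_size i)%N ->
  content_at (offset i + j) = first_content i + j%:Z.
Proof.
by move=> ir jr; rewrite /content_at box_atE //= /first_content; lia.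
Qed.

Lemma parallelE i i' : parallel la i.+1 i'.+1 =
  (first_content i == first_content i') && (last_content i == last_content i').
Proof. by []. Qed.

Definition delta_pair (k l : nat) : bool :=
  [&& (k < l)%N, (box_at k).2 == (row la (box_at k).1).1,
      (box_at l).2 == (row la (box_at l).1).1 & parallel la (box_at k).1 (box_at l).1].

Lemma delta_pairE i j i' j' : (i < size la)%N -> (j < row_size i)%N ->
    (i' < size la)%N -> (j' < row_size i')%N ->
  delta_pair (offset i + j) (offset i' + j') =
  [&& (offset i + j < offset i' + j')%N, j == 0%N, j' == 0%N & parallel la i.+1 i'.+1].
Proof.
move=> ir jr ir' jr'; rewrite /delta_pair !box_atE //=; congr [&& _, _, _ & _]; lia.
Qed.

Hypothesis hla : cherednik la.

Lemma row_valid i : (i < size la)%N -> (row la i.+1).1 <= (row la i.+1).2.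
Proof. by move=> ir; case/andP: hla => /(all_nthP (0, 0)) h _; exact: h. Qed.

Lemma row_sizeE i : (i < size la)%N -> (row_size i)%:Z = last_content i - first_content i + 1.
Proof.
move=> ir; rewrite /row_size (nth_map (0, 0)) // /row_length -/(row la i.+1).
by have := row_valid ir; rewrite /last_content /first_content; lia.
Qed.

(** The Cherednik condition says that the pairs of the last and the first
    content decrease lexicographically from one row to the next. *)
Lemma rows_sorted i i' : (i <= i')%N -> (i' < size la)%N ->
  last_content i' <= last_content i /\
  (last_content i' = last_content i -> first_content i' <= first_content i).
Proof.
elim: i' => [|i' IH]; first by rewrite leqn0 => /eqP->.
rewrite leq_eqVlt => /predU1P[->//|]; rewrite ltnS => le ir.
have [h1 h2] := IH le (ltnW ir).
have : (last_content i'.+1 <= last_content i') /\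
  (last_content i'.+1 = last_content i' -> first_content i'.+1 <= first_content i').
  case/andP: hla => _ /(sortedP (0, 0)) /(_ _ ir).
  rewrite /last_content /first_content /Defs.row /=.
  by move: (nth _ la i'.+1) (nth _ la i') => [a b] [c d] /=; lia.
case=> h3 h4; split; first by exact: le_trans h3 h1.
move=> e; have e' : last_content i'.+1 = last_content i' by lia.
by have := h4 e'; have := h2 ltac:(lia); lia.
Qed.
End DiagramLabels.
(** * Regularity along the family of a diagram *)

Section DiagramRegularity.
Variables (K : fieldType) (q : K) (la : seq (int * int)).
Hypotheses (q0 : q != 0) (q_inf : forall d, (0 < d)%N -> q ^+ d != 1).
Local Notation n := (degree la).
Local Notation p := (@content_point K q la).
Local Notation row_size := (row_size la).
Local Notation offset := (offset la).
Local Notation content_at := (content_at la).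
Local Notation first_content := (first_content la).
Local Notation last_content := (last_content la).
Implicit Types (x : 'I_n -> K).

Definition family x := Fspace q x /\ generic x.

Lemma expz_q_inj : injective (fun c : int => q ^ c).
Proof.
have W c d : q ^ (c + d.+1%:Z) != q ^ c.
  apply/eqP; rewrite expfzDr // -[RHS]mulr1.
  move/(mulfI (expfz_neq0 _ q0))/eqP; exact/negP/q_inf.
move=> c c' /= E; have [lt|lt|//] := ltgtP c c'.
  have := W c (absz (c' - c)).-1; rewrite (_ : c + _ = c') ?E ?eqxx //; lia.
have := W c' (absz (c - c')).-1; rewrite (_ : c' + _ = c) ?E ?eqxx //; lia.
Qed.

Lemma q_neq1 : q != 1. Proof. by have := q_inf (ltn0Sn 0); rewrite expr1. Qed.

Lemma q1_neq0 : q + 1 != 0.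
Proof.
apply: contraNneq (q_inf (ltn0Sn 1)) => /eqP.
by rewrite addr_eq0 => /eqP->; rewrite sqrrN expr1n.
Qed.

Lemma content_pointE (k : 'I_n) : p k = q ^ content_at k.
Proof. by []. Qed.

Lemma content_point_eq (k l : 'I_n) : (p k == p l) = (content_at k == content_at l).
Proof. exact: (inj_eq expz_q_inj). Qed.

Lemma content_point_neq0 (k : 'I_n) : p k != 0.
Proof. exact: expfz_neq0. Qed.

(** On the family, a step to the right in a row multiplies the coordinate by
    q. *)
Lemma family_next x i j (k k' : 'I_n) : (i < size la)%N -> (j.+1 < row_size i)%N ->
  k = (offset i + j)%N :> nat -> k' = (offset i + j).+1 :> nat -> family x ->
  x k' = q * x k.
Proof.
move=> ir jr kE k'E [Fx _]; have jr' := ltnW jr.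
have b : box k = box_at la (offset i + j) by rewrite -kE.
have b' : box k' = box_at la (offset i + j.+1) by rewrite addnS -k'E.
have := Fx k' k; rewrite b b' !box_atE // => /(_ erefl).
have -> : content k = first_content i + j%:Z by rewrite /content b -content_atE.
have -> : content k' = first_content i + j%:Z + 1.
  by rewrite /content b' -[LHS]/(content_at _) content_atE //; lia.
move: (first_content i + j%:Z) => c; rewrite expfzDr // expr1z mulrC -mulrA.
exact: (mulfI (expfz_neq0 _ q0)).
Qed.

Local Notation R := (regular_arrangement q family p (fun k l : 'I_n => delta_pair la k l)).
Local Notation crosses := (crosses R).

Lemma crosses_row_letters i a b : (i < size la)%N ->
    (offset i <= a < b)%N -> (b < offset i + row_size i)%N -> crosses [:: a] [:: b].
Proof.
move=> ir /andP[ia ab] bi.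
apply: crosses_letters => //; do ?[exact: q_neq1|exact: q1_neq0|exact: content_point_neq0].
  by move=> x [].
move=> k l ka lb; left; rewrite content_point_eq ka lb.
rewrite -(subnKC ia) -(subnKC (leq_trans ia (ltnW ab))) !content_atE //; lia.
Qed.

Hypothesis hla : cherednik la.

(** If the last content of the first row is larger, letters of the second row
    cross the whole first row: a box of the first row with the content of b is
    not its last box. Otherwise letters of the first row cross the whole second
    row: a box of the second row with the content of a is not its first box,
    unless the rows are parallel and both boxes are leftmost. *)
Lemma crosses_rows i i' : (i < i')%N -> (i' < size la)%N ->
  crosses (rev (iota (offset i) (row_size i))) (rev (iota (offset i') (row_size i'))).
Proof.
move=> ii ir'; have ir := ltn_trans ii ir'.
have sep := block_before ii ir.
have Dgen x : family x -> generic x by case.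
have [le eqc] := rows_sorted hla (ltnW ii) ir'.
have si := row_sizeE hla ir; have si' := row_sizeE hla ir'.
have ltor : last_content i' < last_content i \/ last_content i' = last_content i by lia.
case: ltor => [lt|eql].
  apply: crosses_allr => b; rewrite mem_rev mem_iota => bi'.
  apply: crosses_row_letter => a ai.
  have [j jE] : exists j, a = (offset i + j)%N by exists (a - offset i)%N; lia.
  have [j' jE'] : exists j, b = (offset i' + j)%N by exists (b - offset i')%N; lia.
  have jr : (j < row_size i)%N by lia.
  have jr' : (j' < row_size i')%N by lia.
  have ca : content_at a = first_content i + j%:Z by rewrite jE content_atE.
  have cb : content_at b = first_content i' + j'%:Z by rewrite jE' content_atE.
  have [ce|cn] := eqVneq (content_at a) (content_at b); last first.
    left; apply: crosses_letters => //;
      do ?[exact: q_neq1|exact: q1_neq0|exact: content_point_neq0|lia].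
    by move=> k l ka lb; left; rewrite content_point_eq ka lb.
  have jr1 : (j.+1 < row_size i)%N by lia.
  right; split; first by lia.
  apply: crosses_row_pair_letter => //;
    do ?[exact: q_neq1|exact: q1_neq0|exact: content_point_neq0|lia].
  - by move=> k k' ka ka' x; apply: (family_next ir jr1); rewrite ?ka ?ka' jE.
  - move=> k l ka lb; rewrite content_point_eq ka lb jE -addnS content_atE //.
    by move: ca ce; rewrite cb; lia.
apply: crosses_alll => a; rewrite mem_rev mem_iota => ai.
apply: crosses_letter_row => b bi.
have [j jE] : exists j, a = (offset i + j)%N by exists (a - offset i)%N; lia.
have [j' jE'] : exists j, b = (offset i' + j)%N by exists (b - offset i')%N; lia.
have jr : (j < row_size i)%N by lia.
have jr' : (j' < row_size i')%N by lia.
have ca : content_at a = first_content i + j%:Z by rewrite jE content_atE.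
have cb : content_at b = first_content i' + j'%:Z by rewrite jE' content_atE.
have ab : (a < b)%N by lia.
have [good|bad] := pselect (content_at a <> content_at b \/ delta_pair la a b).
  left; apply: crosses_letters => //;
    do ?[exact: q_neq1|exact: q1_neq0|exact: content_point_neq0].
  move=> k l ka lb; rewrite content_point_eq ka lb.
  by case: good => [/eqP|]; [left|right].
have ce : content_at a = content_at b by apply: contrapT => ne; apply: bad; left.
(* equality of contents leaves only the pair counted in delta for j' = 0 *)
have j0 : j' != 0%N.
  apply/eqP=> j0; apply: bad; right.
  have e2 := eqc eql; rewrite jE jE' delta_pairE // parallelE.
  by move: ce; rewrite ca cb => ce; apply/and4P; split; lia.
right; split; first by lia.
have bE : b = b.-1.+1 by lia.
rewrite [in X in crosses _ [:: X; _]]bE.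
have jr1 : (j'.-1.+1 < row_size i')%N by lia.
apply: crosses_letter_row_pair => //;
  do ?[exact: q_neq1|exact: q1_neq0|exact: content_point_neq0|lia].
- by move=> k k' kb kb' x; apply: (family_next ir' jr1); rewrite ?kb ?kb' jE'; lia.
- move=> k l ka lb; rewrite content_point_eq ka lb.
  have -> : b.-1 = (offset i' + j'.-1)%N by lia.
  by rewrite content_atE; lia.
Qed.

Lemma pairwise_iota (P : rel nat) s m :
  (forall a b, (s <= a < b)%N -> (b < s + m)%N -> P a b) -> pairwise P (iota s m).
Proof.
elim: m s => // m IH s h; rewrite [iota _ _]/= pairwise_cons; apply/andP; split.
  by apply/allP => b; rewrite mem_iota => bm; apply: h; lia.
by apply: IH => a b ab bm; apply: h; lia.
Qed.

Lemma regular_reversal : R (rev (iota 0 n)).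
Proof.
have h1 : R (iota 0 n).
  exists 1%g; split; last by apply: regular_perm1 => x [].
  by rewrite /arrangement -[RHS]val_enum_ord; apply: eq_map => i; rewrite perm1.
have := @reverse_blocks _ R (blocks la) [::] [::].
rewrite flatten_blocks !cats0; apply=> //.
  move=> u; rewrite /blocks; case/(@mapP nat (seq nat))=> i.
  rewrite mem_iota => /andP[_ ir] ->; apply: pairwise_iota.
  by move=> a b ab bi; apply/asboolP; exact: crosses_row_letters ab bi.
rewrite pairwise_map; apply: pairwise_iota => i i' /andP[_ ii] ir.
by apply/asboolP; exact: crosses_rows.
Qed.

Lemma regular_delta_phi (w0 : 'S_n) s : longest w0 -> reduced w0 s ->
  regular family p (fun x => delta x *: phi_word q s x).
Proof.
move=> lw rs; have [w [aw rw]] := regular_reversal.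
have ww : w = w0.
  apply/permP => i; apply/val_inj; rewrite (longest_rev i lw) /= -nth_arrangement aw.
  by rewrite nth_rev size_iota ?nth_iota ?add0n //= ; have := ltn_ord i; lia.
apply: (regular_ext _ rw) => x [Fx gx]; rewrite ww.
have sw : word_perm s = w0 by case: rs.
rewrite (phi_permE q gx (reducedP rs)) sw; congr (_ *: _).
rewrite /delta /crossed_delta /crossing_factor pair_big_dep /= -big_mkcondr.
apply: eq_bigl => -[k l]; rewrite (longest_inversions _ _ lw) /delta_pair /=.
by case: (ltnP k l).
Qed.
End DiagramRegularity.
(** * Density of the generic points of the family *)

Section FamilyDensity.
Variables (K : fieldType) (q : K) (la : seq (int * int)).
Hypotheses (q0 : q != 0) (q_inf : forall d, (0 < d)%N -> q ^+ d != 1).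
Local Notation n := (degree la).
Local Notation p := (@content_point K q la).

Lemma box_inj (k l : 'I_n) : (box k).1 = (box l).1 -> content k = content l -> k = l.
Proof.
have [i [j [ir jr kE]]] := labelP (ltn_ord k).
have [i' [j' [ir' jr' lE]]] := labelP (ltn_ord l).
have bk : box k = box_at la (offset la i + j) by rewrite -kE.
have bl : box l = box_at la (offset la i' + j') by rewrite -lE.
rewrite /content bk bl !box_atE //= => -[ii]; subst i' => e.
by apply: val_inj; rewrite /= kE lE; lia.
Qed.

(** A curve in the family through the given point, at t = 1. *)
Definition curve (t : K) : 'I_n -> K := fun k => t ^+ (box k).1 * q ^ content k.

Lemma curve1 : curve 1 = p.
Proof. by apply/funext => k; rewrite /curve expr1n mul1r. Qed.

Lemma curve_Fspace t : Fspace q (curve t).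
Proof. by move=> k l e; rewrite /curve e; ring. Qed.

(** For t = q ^ N the coordinates are powers of q with exponents N i + c, where
    i is the row; these are distinct once N exceeds all differences of contents. *)
Lemma curve_family : exists N0, forall N, (N0 <= N)%N -> family q (curve (q ^+ N)).
Proof.
pose M := (\max_(k < n) absz (content k))%N.
have leM (k : 'I_n) : (absz (content k) <= M)%N by exact: leq_bigmax.
(* differences of contents are at most 2 M in absolute value *)
exists (M + M).+1 => N leN; split; first exact: curve_Fspace.
have E k : curve (q ^+ N) k = q ^ ((N * (box k).1)%N%:Z + content k).
  by rewrite /curve expfzDr // -exprM.
split=> [k l|k]; last by rewrite E expfz_neq0.
rewrite !E => /(expz_q_inj q0 q_inf) e.
have lk := leM k; have ll := leM l.
have rows : (box k).1 = (box l).1.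
  case: (ltngtP (box k).1 (box l).1) => // /subnKC <- in e *; nia.
by apply: box_inj => //; move: e; rewrite rows => /addrI.
Qed.

Lemma family_nonempty : exists x : 'I_n -> K, family q x.
Proof. by have [N0 h] := curve_family; exists (curve (q ^+ N0)); apply: h. Qed.

(** Along the curve P becomes a polynomial in t with the infinitely many roots
    q ^ N, hence 0. *)
Lemma family_dense (P : {mpoly K[n]}) :
  (forall x, family q x -> P.@[x] = 0) -> P.@[p] = 0.
Proof.
move=> P0; have [N0 hN] := curve_family.
pose P' : {poly K} := \sum_(m <- msupp P)
  (P@_m)%:P * \prod_i ('X ^+ (box i).1 * (q ^ content i)%:P) ^+ m i.
have ev t : P'.[t] = P.@[curve t].
  rewrite mevalE horner_sum; apply: eq_bigr => m _.
  rewrite hornerM hornerC horner_prod; congr (_ * _); apply: eq_bigr => i _.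
  by rewrite horner_exp hornerM hornerXn hornerC.
rewrite -curve1 -ev; suff -> : P' = 0 by rewrite horner0.
apply/eqP/negPn/negP => nz.
pose rs := [seq q ^+ (N0 + m) | m <- iota 0 (size P')].
have rts : all (root P') rs.
  apply/allP => t /mapP[m _ ->]; rewrite /root ev P0 //; apply: hN.
  exact: leq_addr.
have uq : uniq rs.
  rewrite map_inj_uniq ?iota_uniq // => a b e.
  have := expz_q_inj q0 q_inf (_ : q ^ (N0 + a)%N%:Z = q ^ (N0 + b)%N%:Z).
  by move=> /(_ e); lia.
by have := max_poly_roots nz rts uq; rewrite size_map size_iota ltnn.
Qed.
End FamilyDensity.
(** * Functions regular and nonzero at a point *)

Section UnitFunctions.
Variables (K : fieldType) (n : nat) (D : ('I_n -> K) -> Prop) (p : 'I_n -> K).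
Implicit Type f : ('I_n -> K) -> K.

Definition unit_scalar f := exists A B : {mpoly K[n]},
  [/\ A.@[p] != 0, B.@[p] != 0 & forall x, D x -> B.@[x] * f x = A.@[x]].

Lemma unit_scalar_ext f g : (forall x, D x -> f x = g x) -> unit_scalar f -> unit_scalar g.
Proof. by move=> E [A [B [A0 B0 h]]]; exists A, B; split=> // x Dx; rewrite -E // h. Qed.

Lemma unit_scalar1 : unit_scalar (fun=> 1).
Proof. by exists 1, 1; rewrite meval1 oner_neq0; split=> // x _; rewrite meval1 mulr1. Qed.

Lemma unit_scalarM f g : unit_scalar f -> unit_scalar g -> unit_scalar (fun x => f x * g x).
Proof.
move=> [A [B [A0 B0 h]]] [A' [B' [A0' B0' h']]]; exists (A * A'), (B * B').
rewrite !mevalM !mulf_neq0 //; split=> // x Dx.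
by rewrite !mevalM mulrACA h // h'.
Qed.

Lemma unit_scalar_prod (I : eqType) (r : seq I) (f : I -> ('I_n -> K) -> K) :
  (forall i, i \in r -> unit_scalar (f i)) -> unit_scalar (fun x => \prod_(i <- r) f i x).
Proof.
elim: r => [|i r IH] h.
  by apply: (unit_scalar_ext _ unit_scalar1) => x _; rewrite big_nil.
have h1 := h i (mem_head i r).
have h2 := IH (fun j jr => h j (mem_behead (jr : j \in behead (i :: r)))).
by apply: (unit_scalar_ext _ (unit_scalarM h1 h2)) => x _; rewrite big_cons.
Qed.

Lemma unit_scalar_frac (A B : {mpoly K[n]}) f : A.@[p] != 0 -> B.@[p] != 0 ->
  (forall x, D x -> B.@[x] != 0 /\ f x = A.@[x] / B.@[x]) -> unit_scalar f.
Proof.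
move=> A0 B0 h; exists A, B; split=> // x /h[Bx ->].
by rewrite mulrC divfK.
Qed.
End UnitFunctions.

(** * The leading coefficient of phi_0, row by row *)

Section LeadingUnit.
Variables (K : fieldType) (q : K) (la : seq (int * int)).
Hypotheses (q0 : q != 0) (q_inf : forall d, (0 < d)%N -> q ^+ d != 1).
Local Notation n := (degree la).
Local Notation p := (@content_point K q la).
Local Notation row_size := (row_size la).
Local Notation offset := (offset la).
Local Notation content_at := (content_at la).
Local Notation first_content := (first_content la).
Local Notation last_content := (last_content la).
Implicit Types (x : 'I_n -> K).
Local Notation family := (@family K q la).
Local Notation unit_scalar := (unit_scalar family p).

(** The number of the first row parallel to row i. As parallel rows are
    consecutive, it is nondecreasing in i for Cherednik diagrams. *)
Definition parallel_class (i : nat) : nat :=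
  find (fun i' => parallel la i'.+1 i.+1) (iota 0 (size la)).

Definition class_at (k : nat) : nat := parallel_class (box_at la k).1.-1.

Lemma parallel_classE i i' : (i < size la)%N -> (i' < size la)%N ->
  (parallel_class i == parallel_class i') = parallel la i.+1 i'.+1.
Proof.
move=> ir ir'; have P j : (j < size la)%N ->
    parallel la (parallel_class j).+1 j.+1 /\ (parallel_class j < size la)%N.
  move=> jr; have hs : has (fun i' => parallel la i'.+1 j.+1) (iota 0 (size la)).
    by apply/hasP; exists j; rewrite ?mem_iota // parallelE !eqxx.
  have := hs; rewrite has_find size_iota => lt; split=> //.
  by have := nth_find 0%N hs; rewrite nth_iota.
have [h1 _] := P i ir; have [h2 _] := P i' ir'; apply/eqP/idP => [E|h].
  by move: h1 h2; rewrite E !parallelE; lia.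
rewrite /parallel_class; apply: eq_find => j.
by move: h; rewrite !parallelE; lia.
Qed.

(** Labels as natural numbers make the rows intervals of indices in products. *)
Definition coord x (m : nat) : K := oapp x 0 (insub m).

Lemma coord_ord x (k : 'I_n) : coord x k = x k.
Proof. by rewrite /coord valK. Qed.

Definition pair_factor x (k l : nat) : K := if (k < l)%N then
   (if delta_pair la k l then 1 - coord x l / coord x k else 1) *
   (if class_at k == class_at l then q + bracket q (coord x l / coord x k) else 1)
  else 1.

Lemma q_bracket (a b : K) : a != 0 -> a != b -> q + bracket q (b / a) = (a - q * b) / (a - b).
Proof.
by move=> a0 ab; rewrite bracketE //; rewrite -subr_eq0 in ab; field.
Qed.

Lemma pair_factor_unit (k l : 'I_n) :
    ((k < l)%N -> content_at k != content_at l /\ content_at k != content_at l + 1) ->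
  unit_scalar (fun x => pair_factor x k l).
Proof.
rewrite /pair_factor; case: ltnP => [lt|_ _]; last exact: unit_scalar1.
move=> /(_ isT)[kl kl1].
have -> : delta_pair la k l = false.
  apply/negP=> /and4P[_ /eqP lk /eqP ll /andP[/eqP e _]].
  by move/eqP: kl; apply; rewrite /content_at lk ll.
case: eqP => _; last by apply: (unit_scalar_ext _ (unit_scalar1 _ _)) => x _; rewrite mulr1.
apply: (@unit_scalar_frac _ _ _ _ ('X_k - q%:MP * 'X_l) ('X_k - 'X_l)).
- rewrite mevalB mevalM mevalC !mevalXU subr_eq0 !content_pointE.
  rewrite -{2}[q]expr1z -expfzDr // (inj_eq (expz_q_inj q0 q_inf)) addrC.
  by rewrite addrC in kl1 *.
- by rewrite mevalB !mevalXU subr_eq0 content_point_eq.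
move=> x [_ [xI x0]]; rewrite !mevalB mevalM mevalC !mevalXU !coord_ord mul1r.
have kl' : k != l by rewrite -val_eqE neq_ltn lt.
by rewrite subr_eq0 (inj_eq xI) q_bracket // (inj_eq xI).
Qed.

Lemma coord_row x i j : family x -> (i < size la)%N -> (j < row_size i)%N ->
  coord x (offset i + j) = q ^+ j * coord x (offset i).
Proof.
move=> fx ir; elim: j => [|j IH] jr; first by rewrite addn0 expr0 mul1r.
rewrite exprS -mulrA -IH 1?ltnW // addnS.
have k1 := label_lt ir (ltnW jr); have := label_lt ir jr; rewrite addnS => k2.
have -> : coord x (offset i + j).+1 = x (Ordinal k2) by rewrite -coord_ord.
have -> : coord x (offset i + j) = x (Ordinal k1) by rewrite -coord_ord.
exact: (family_next q0 ir jr).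
Qed.

Lemma coord_neq0 x k : family x -> (k < n)%N -> coord x k != 0.
Proof.
by move=> [_ [_ x0]] kn; rewrite -[k]/(nat_of_ord (Ordinal kn)) coord_ord.
Qed.

Lemma coord_inj x k l : family x -> (k < n)%N -> (l < n)%N -> k != l ->
  coord x k != coord x l.
Proof.
move=> [_ [xI _]] kn ln; apply: contraNneq.
by rewrite -[k]/(nat_of_ord (Ordinal kn)) -[l]/(nat_of_ord (Ordinal ln)) !coord_ord => /xI ->.
Qed.

(** The factor q + <x_l / x_k> is (x_k - q x_l) / (x_k - x_l), and q x_l is the
    coordinate of the next box, so the product over a row telescopes. *)
Lemma parallel_row_product x i j i' m : family x -> (i < i')%N -> (i' < size la)%N ->
    (j < row_size i)%N -> (m < row_size i')%N -> parallel la i.+1 i'.+1 ->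
  let k := (offset i + j)%N in let t := offset i' in
  \prod_(l <- iota t m.+1) pair_factor x k l =
  (if j == 0%N then 1 - coord x t / coord x k else 1) *
  ((coord x k - q ^+ m.+1 * coord x t) / (coord x k - coord x t)).
Proof.
move=> fx ii ir' jr mr par k t; have ir := ltn_trans ii ir'.
have kt : (k < t)%N by have := block_before ii ir; rewrite /k /t; lia.
have kn : (k < n)%N by exact: label_lt.
have tn j' : (j' < row_size i')%N -> (t + j' < n)%N by exact: label_lt.
have xk := coord_neq0 fx kn.
have F j' : (j' < row_size i')%N -> pair_factor x k (t + j') =
    (if (j == 0%N) && (j' == 0%N) then 1 - coord x t / coord x k else 1) *
    ((coord x k - q ^+ j'.+1 * coord x t) / (coord x k - q ^+ j' * coord x t)).
  move=> jr'; have klt : (k < t + j')%N by lia.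
  rewrite /pair_factor klt delta_pairE // par klt /= andbT.
  rewrite /class_at !box_atE //= parallel_classE // par.
  have ne : coord x k != coord x (t + j') by apply: coord_inj => //; [exact: tn|lia].
  rewrite q_bracket // (coord_row fx ir' jr') exprS mulrA; congr (_ * _).
  by case: eqP => // _; case: eqP => // ->; rewrite expr0 mul1r.
elim: m mr => [|m IH] mr.
  by rewrite big_seq1 -[t in LHS]addn0 F // expr0 mul1r andbT.
rewrite -[in iota _ _]addn1 iotaD big_cat big_seq1 /= IH 1?ltnW // F // andbF mul1r.
rewrite -mulrA; congr (_ * _).
have ne : coord x k != coord x (t + m.+1) by apply: coord_inj => //; [exact: tn|lia].
rewrite (coord_row fx ir' mr) -subr_eq0 in ne.
by rewrite mulrC mulrA divfK.
Qed.

Hypothesis hla : cherednik la.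

(** In the row of k the factors are nonzero constants. In a later parallel row,
    the numerator left by telescoping belongs to the content after the last one
    and does not vanish. The denominator belongs to the leftmost box; it vanishes
    only if k is leftmost too, and then the factor of delta cancels it. *)
Lemma row_factor_unit (k : 'I_n) i' : (i' < size la)%N ->
  unit_scalar (fun x => \prod_(l <- iota (offset i') (row_size i')) pair_factor x k l).
Proof.
move=> ir'; have [i [j [ir jr kE]]] := labelP (ltn_ord k).
have si' := row_sizeE hla ir'; have vi' := row_valid hla ir'.
have ck : content_at k = first_content i + j%:Z by rewrite kE content_atE.
have cl j' : (j' < row_size i')%N -> content_at (offset i' + j') = first_content i' + j'%:Z.
  exact: content_atE.
have triv : (forall x l, (offset i' <= l < offset i' + row_size i')%N ->
    pair_factor x k l = 1) -> unit_scalar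
    (fun x => \prod_(l <- iota (offset i') (row_size i')) pair_factor x k l).
  move=> E; apply: (unit_scalar_ext _ (unit_scalar1 _ _)) => x _.
  by rewrite big_seq big1 // => l; rewrite mem_iota; exact: E.
have [ii|ii|ii] := ltngtP i i'.
- have sep := block_before ii ir.
  have [par|npar] := boolP (parallel la i.+1 i'.+1); last first.
    apply: triv => x l lr; have lE : l = (offset i' + (l - offset i'))%N by lia.
    have lr' : (l - offset i' < row_size i')%N by lia.
    rewrite /pair_factor; case: ltnP => // _.
    rewrite [in delta_pair _ _ _]lE [in delta_pair _ _ _]kE delta_pairE //.
    rewrite (negPf npar) !andbF.
    rewrite /class_at lE kE !box_atE // parallel_classE // (negPf npar).
    by rewrite mul1r.
  have t0 : (0 < row_size i')%N by move: si'; rewrite /last_content /first_content; lia.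
  have tn : (offset i' < n)%N by rewrite -[offset i']addn0; exact: label_lt.
  pose t := Ordinal tn.
  have rs : row_size i' = (row_size i').-1.+1 by lia.
  have mr : ((row_size i').-1 < row_size i')%N by lia.
  have ct : content_at t = first_content i' by rewrite /= -[offset i']addn0 cl // addr0.
  have pk : p k - q ^+ row_size i' * p t != 0.
    rewrite subr_eq0 !content_pointE ct ck exprnP -expfzDr // (inj_eq (expz_q_inj q0 q_inf)).
    by move: par; rewrite parallelE; have := row_sizeE hla ir; lia.
  have E x : family x ->
      \prod_(l <- iota (offset i') (row_size i')) pair_factor x k l =
      (if j == 0%N then 1 - x t / x k else 1) *
      ((x k - q ^+ row_size i' * x t) / (x k - x t)).
    move=> fx; rewrite [in LHS]rs kE (parallel_row_product fx) // -rs -kE.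
    by rewrite coord_ord (_ : coord x (offset i') = x t) // -coord_ord.
  have [j0|j0] := eqVneq j 0%N.
    apply: (@unit_scalar_frac _ _ _ _ ('X_k - (q ^+ row_size i')%:MP * 'X_t) 'X_k).
    + by rewrite mevalB mevalM mevalC !mevalXU.
    + by rewrite mevalXU (content_point_neq0 q0).
    move=> x fx; have [_ [xI x0]] := fx; rewrite E // j0 eqxx.
    rewrite mevalB mevalM mevalC !mevalXU; split=> //.
    have kt : x k - x t != 0 by rewrite subr_eq0 (inj_eq xI) -val_eqE /= kE; lia.
    by have xk := x0 k; field; rewrite xk kt.
  apply: (@unit_scalar_frac _ _ _ _ ('X_k - (q ^+ row_size i')%:MP * 'X_t) ('X_k - 'X_t)).
  + by rewrite mevalB mevalM mevalC !mevalXU.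
  + rewrite mevalB !mevalXU subr_eq0 (content_point_eq q0 q_inf) ck ct.
    by move: par; rewrite parallelE; lia.
  move=> x fx; have [_ [xI x0]] := fx; rewrite E // (negPf j0) mul1r.
  rewrite !mevalB mevalM mevalC !mevalXU; split=> //.
  by rewrite subr_eq0 (inj_eq xI) -val_eqE /= kE; lia.
- have sep := block_before ii ir'.
  by apply: triv => x l lr; rewrite /pair_factor ltnNge (_ : (l <= k)%N) //; lia.
subst i'; apply: unit_scalar_prod => l; rewrite mem_iota => lr.
have lE : l = (offset i + (l - offset i))%N by lia.
have lr' : (l - offset i < row_size i)%N by lia.
have ln : (l < n)%N by rewrite lE; exact: label_lt.
apply: (@pair_factor_unit k (Ordinal ln)) => /= kl.
by rewrite ck lE cl //; lia.
Qed.
End LeadingUnit.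
(** * Nonvanishing *)

Section Nonvanishing.
Variables (K : fieldType) (q : K) (la : seq (int * int)).
Hypotheses (q0 : q != 0) (q_inf : forall d, (0 < d)%N -> q ^+ d != 1).
Hypothesis hla : cherednik la.
Local Notation n := (degree la).
Local Notation p := (@content_point K q la).
Local Notation family := (@family K q la).
Implicit Types (x : 'I_n -> K).

(** A row between two parallel rows is parallel to both, since its last and
    first contents are squeezed between theirs. *)
Lemma parallel_class_mono i i' : (i <= i')%N -> (i' < size la)%N ->
  (parallel_class la i <= parallel_class la i')%N.
Proof.
move=> ii ir'; have ir := leq_ltn_trans ii ir'.
rewrite leqNgt; apply/negP=> lt.
have le : (parallel_class la i <= i)%N.
  rewrite leqNgt; apply/negP=> /(before_find 0%N).
  by rewrite nth_iota // parallelE !eqxx.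
set h := parallel_class la i' in lt; have hi : (h < i)%N := leq_trans lt le.
have : parallel la h.+1 i'.+1.
  have hs : has (fun j => parallel la j.+1 i'.+1) (iota 0 (size la)).
    by apply/hasP; exists i'; rewrite ?mem_iota // parallelE !eqxx.
  have := nth_find 0%N hs; rewrite nth_iota //.
  by rewrite -/(parallel_class la i') -/h; lia.
have [h1 h2] := rows_sorted hla ii ir'; have [h3 h4] := rows_sorted hla (ltnW hi) ir.
have := before_find 0%N lt; rewrite nth_iota ?add0n; last by lia.
rewrite !parallelE => e1 e2.
by have := h2 ltac:(lia); have := h4 ltac:(lia); lia.
Qed.

Lemma class_at_mono (k l : 'I_n) : (k <= l)%N -> (class_at la k <= class_at la l)%N.
Proof.
have [i [j [ir jr ->]]] := labelP (ltn_ord k).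
have [i' [j' [ir' jr' ->]]] := labelP (ltn_ord l).
move=> le; rewrite /class_at !box_atE //=; apply: parallel_class_mono => //.
by rewrite leqNgt; apply/negP=> /block_before-/(_ _ ir'); lia.
Qed.

(** The value of [word_coef_leading] for the letters [class_at]. *)
Definition leading_coefficient (w : 'S_n) x : K :=
  \prod_(ab in inversions w)
    (if class_at la ab.1 == class_at la ab.2 then q + bracket q (x ab.2 / x ab.1) else 1).

Lemma big_labels (F : nat -> K) :
  \prod_(l < n) F l = \prod_(u <- blocks la) \prod_(l <- u) F l.
Proof.
by rewrite -big_flatten flatten_blocks -(big_mkord predT F) /index_iota subn0.
Qed.

Lemma delta_leading_unit (w : 'S_n) : longest w ->
  unit_scalar family p (fun x => delta x * leading_coefficient w x).
Proof.
move=> lw.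
apply: (@unit_scalar_ext _ _ _ _ (fun x => \prod_(k <- enum 'I_n)
    \prod_(u <- blocks la) \prod_(l <- u) pair_factor q x k l)); last first.
  apply: unit_scalar_prod => k _; apply: unit_scalar_prod => u.
  rewrite /blocks; case/(@mapP nat (seq nat)) => i; rewrite mem_iota => /andP[_ ir] ->.
  exact: row_factor_unit.
move=> x fx; rewrite big_enum /= /delta /leading_coefficient.
have -> : \prod_(ab in inversions w) (if class_at la ab.1 == class_at la ab.2
      then q + bracket q (x ab.2 / x ab.1) else 1) =
    \prod_(k < n) \prod_(l < n | (k < l)%N) (if class_at la k == class_at la l
      then q + bracket q (x l / x k) else 1).
  rewrite pair_big_dep /=; apply: eq_bigl => -[k l].
  by rewrite (longest_inversions _ _ lw).
rewrite -big_split /=; apply: eq_bigr => k _; rewrite -big_labels.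
rewrite (eq_bigl (fun l : 'I_n => (k < l)%N && delta_pair la k l)) => [|l]; last first.
  by rewrite /delta_pair /=; case: (ltnP k l).
rewrite big_mkcondr -big_split /=. rewrite [RHS]big_mkcond; apply: eq_bigr => l _.
by rewrite /pair_factor !coord_ord.
Qed.

(** The functional [th] reads off the coefficient of the reversed word. Applied
    to Q * delta * phi_0 = N, it gives a polynomial identity B * M = Q * A on the
    generic points of the family, where A / B is the unit of
    [delta_leading_unit]; by density it holds at p, where the right-hand side is
    nonzero. *)
Lemma delta_phi_regular_nonzero (w0 : 'S_n) s : longest w0 -> reduced w0 s ->
  exists2 v : hecke q n.-1, v != 0 &
    restriction_regular_at (@Fspace K q la) (@generic K n)
      (fun x => delta x *: phi_word q s x) p v.
Proof.
move=> lw rs; have sw : word_perm s = w0 by case: rs.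
have [Q [N [[m [P [e NE]]] Q0 h]]] := regular_delta_phi q0 q_inf hla lw rs.
have [A [B [A0 B0 hAB]]] := delta_leading_unit lw.
pose g : 'I_n -> nat := fun k => class_at la k.
pose th (y : hecke q n.-1) := hecke_act y (start_vector K g) (spread_word g w0).
pose M : {mpoly K[n]} := \sum_(j < m) th (e j) *: P j.
have thN x : th (N x) = M.@[x].
  rewrite NE /th hecke_act_sum /M rmorph_sum /=; apply: eq_bigr => j _.
  by rewrite hecke_actZ mevalZ mulrC.
have thphi x : th (delta x *: phi_word q s x) = delta x * leading_coefficient w0 x.
  rewrite /th hecke_actZ; congr (_ * _).
  have := @word_coef_leading _ q _ g class_at_mono s x (reducedP rs).
  by rewrite sw.
have : (B * M - Q * A).@[p] = 0.
  apply: (family_dense q0 q_inf) => x fx; rewrite mevalB !mevalM -thN -hAB // -h //.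
  by rewrite {1}/th hecke_actZ -/(th _) thphi mulrCA subrr.
rewrite mevalB !mevalM => /eqP; rewrite subr_eq0 => /eqP BM.
have M0 : M.@[p] != 0.
  apply: contraTneq (mulf_neq0 Q0 A0) => M0.
  by rewrite -BM M0 mulr0 eqxx.
exists (Q.@[p]^-1 *: N p).
  rewrite scaler_eq0 invr_eq0 negb_or Q0; apply: contraNneq M0 => N0.
  by rewrite -thN N0 -(scale0r 0) /th hecke_actZ mul0r.
split; first by rewrite -curve1; exact: curve_Fspace.
  exact: family_nonempty.
exists m, P, e, Q; split=> //; first by rewrite NE.
by move=> x Fx gx; rewrite -NE; apply: h.
Qed.
End Nonvanishing.

Lemma qvar_neq0 (R : realType) : qvar R != 0.
Proof. by rewrite tofrac_eq0 polyX_eq0. Qed.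

Lemma qvar_exp_neq1 (R : realType) d : (0 < d)%N -> qvar R ^+ d != 1.
Proof.
move=> d0; rewrite /qvar -tofracXn -tofrac1 tofrac_eq.
apply/eqP => /(congr1 (fun f : {poly R[i]} => size f)).
by rewrite size_polyXn size_poly1; lia.
Qed.

(* [s] is an arbitrary reduced decomposition of w_0, so [phi_word _ s] is phi_0. *)
Theorem theorem5 (R : realType) (la : seq (int * int)) (hla : cherednik la)
    (w0 : 'S_(degree la)) (hw0 : longest w0)
    (s : seq 'I_(degree la).-1) (hs : reduced w0 s) :
  exists2 v : hecke (qvar R) (degree la).-1, v != 0 &
    restriction_regular_at (@Fspace (Cq R) (qvar R) la) (@generic (Cq R) (degree la))
      (fun x => delta x *: phi_word (qvar R) s x)
      (@content_point (Cq R) (qvar R) la) v.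
Proof.
exact: (delta_phi_regular_nonzero (qvar_neq0 R) (@qvar_exp_neq1 R) hla hw0 hs).
Qed.
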